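(* Let $(R,\mathfrak m)$ be a Gorenstein local ring of dimension $d$, and let $I$ be an $\mathfrak m$-primary ideal of $R$ containing a parameter ideal $Q=(x_1,\ldots,x_d)$ as a reduction. Suppose that $I$ is an Ulrich ideal but not a parameter ideal. Let $M$ be a stable maximal Cohen-Macaulay $R$-module. Then $M$ is an Ulrich $R$-module with respect to $I$ if and only if $\lambda M$ is an Ulrich $R$-module with respect to $I$.
   Context: All rings are commutative and Noetherian with 1; ''finite'' means finitely generated. A finite $R$-module $M$ is maximal Cohen-Macaulay if $\mathrm{depth}_R M=\dim R$ (the zero module, of depth $+\infty$, is not). A finite $R$-module is stable if it has no nonzero free direct summand. A parameter ideal is an ideal generated by a system of parameters. That $Q\subset I$ is a reduction of $I$ means $QI^r=I^{r+1}$ for some $r\ge 0$. The ideal $I$ is Ulrich if $I^2=QI$ and $I/I^2$ is a free $R/I$-module. A finite $R$-module $M$ is Ulrich with respect to $I$ if $M$ is maximal Cohen-Macaulay, $IM=QM$, and $M/IM$ is a free $R/I$-module. For a finite $R$-module $M$ with minimal free presentation $F_1\xrightarrow{\partial_1}F_0\to M\to 0$, the Auslander transpose is $\mathrm{Tr}\,M=\mathrm{coker}(\mathrm{Hom}_R(F_0,R)\xrightarrow{\partial_1^*}\mathrm{Hom}_R(F_1,R))$, and the syzygy module is $\Omega M=\mathrm{Im}\,\partial_1\subset F_0$. Set $\lambda M=\Omega\,\mathrm{Tr}\,M$. *)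

(* Defs.v *)
From HB Require Import structures.
From mathcomp Require Import all_boot all_order all_algebra.
From mathcomp Require Import ring_quotient.
From mathcomp Require Import boolp.

Set Implicit Arguments.
Unset Strict Implicit.
Unset Printing Implicit Defensive.

Import GRing.Theory.

Local Open Scope ring_scope.
Local Open Scope quotient_scope.

(* MathComp submodules and ideals are boolean predicates; propositions are
   turned into such predicates by the classical `[< _ >].  The library's
   [idealr R] and [prime_idealr R] are proper ideals (of a commutative ring). *)

Section Submodules.
Variables (R : comNzRingType) (M : lmodType R).

Definition span (s : seq M) : {pred M} :=
  fun y => `[< exists c : nat -> R, y = \sum_(i < size s) c i *: s`_i >].

Definition fin_gen : Prop := exists s : seq M, forall y : M, y \in span s.

(* The product S N, i.e. the finite sums of elements a *: v with a in S and
   v in N. *)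
Definition pmul (S : {pred R}) (N : {pred M}) : {pred M} :=
  fun y => `[< exists2 s : seq (R * M),
                 (forall p, p \in s -> p.1 \in S /\ p.2 \in N)
               & y = \sum_(p <- s) p.1 *: p.2 >].

Lemma pmul_submod_closed (I : idealr R) (N : {pred M}) :
  submod_closed (pmul I N).
Proof.
split; first by apply/asboolP; exists [::] => //; rewrite big_nil.
move=> a u v /asboolP[s hs ->] /asboolP[t ht ->]; apply/asboolP.
exists ([seq (a * p.1, p.2) | p <- s] ++ t).
  move=> p; rewrite mem_cat => /orP[/mapP[q /hs[q1 q2] ->]|/ht//].
  by split=> //=; apply: idealMr.
rewrite big_cat big_map scaler_sumr; congr (_ + _).
by apply: eq_bigr => p _; rewrite scalerA.
Qed.

HB.instance Definition _ (I : idealr R) (N : {pred M}) :=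
  GRing.isSubmodClosed.Build R M (pmul I N) (pmul_submod_closed I N).

End Submodules.

Definition full {R : comNzRingType} (M : lmodType R) : {pred M} := predT.
Arguments full {R} M _.

Definition pideal (R : comNzRingType) (s : seq R) : {pred R} :=
  span (M := R^o) s.

Definition imul (R : comNzRingType) (S T : {pred R}) : {pred R} :=
  pmul (M := R^o) S T.

Definition ipow (R : comNzRingType) (S : {pred R}) (r : nat) : {pred R} :=
  iter r (imul S) predT.

Section Image.
Variables (R : comNzRingType) (U V : lmodType R) (f : {linear U -> V}).

Definition image_pred : {pred V} := fun y => `[< exists x, f x = y >].

Lemma image_submod_closed : submod_closed image_pred.
Proof.
split; first by apply/asboolP; exists 0; rewrite linear0.
move=> a _ _ /asboolP[x <-] /asboolP[y <-]; apply/asboolP.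
by exists (a *: x + y); rewrite linearP.
Qed.

HB.instance Definition _ :=
  GRing.isSubmodClosed.Build R V image_pred image_submod_closed.

End Image.

Definition submod_of (R : comNzRingType) (M : lmodType R) (N : submodClosed M)
  : Type := {x : M | x \in N}.

HB.instance Definition _ (R : comNzRingType) (M : lmodType R)
    (N : submodClosed M) := SubType.on (submod_of N).
HB.instance Definition _ (R : comNzRingType) (M : lmodType R)
    (N : submodClosed M) := [Choice of submod_of N by <:].
HB.instance Definition _ (R : comNzRingType) (M : lmodType R)
    (N : submodClosed M) := [SubChoice_isSubLmodule of submod_of N by <:].

Section IdealAsModule.
Variables (R : comNzRingType) (I : idealr R).

Definition ideal_pred : {pred R^o} := fun x => x \in I.

Lemma ideal_pred_submod_closed : submod_closed ideal_pred.
Proof.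
split=> [|a u v uI vI]; first exact: (idealr0 I).
by apply: (@rpredD _ I); first exact: (@idealMr _ I).
Qed.

HB.instance Definition _ :=
  GRing.isSubmodClosed.Build R R^o ideal_pred ideal_pred_submod_closed.

Definition ideal_module : lmodType R := submod_of ideal_pred.

End IdealAsModule.

Section QuotientModule.
Variables (R : comNzRingType) (M : lmodType R) (N : submodClosed M).

(* The library's [submodClosed] does not inherit from [zmodClosed], which its
   quotients require. *)
Definition zmod_pred : {pred M} := fun x => x \in N.

HB.instance Definition _ :=
  GRing.isSubmodClosed.Build R M zmod_pred (submodClosedP N).

Definition quot_module : Type := {ideal_quot zmod_pred}.
HB.instance Definition _ :=
  ZmodQuotient.copy quot_module {ideal_quot zmod_pred}.

Definition quot_scale (a : R) (x : quot_module) : quot_module :=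
  \pi_quot_module (a *: repr x).

Lemma quot_scaleE a (x : M) :
  quot_scale a (\pi_quot_module x) = \pi_quot_module (a *: x).
Proof.
apply/eqP; rewrite -Quotient.idealrBE -scalerBr.
by apply: (@rpredZ _ _ zmod_pred); rewrite Quotient.idealrBE reprK eqxx.
Qed.

Lemma quot_scaleA a b x : quot_scale a (quot_scale b x) = quot_scale (a * b) x.
Proof. by rewrite -[x]reprK (quot_scaleE b) !quot_scaleE scalerA. Qed.

Lemma quot_scale1 : left_id 1 quot_scale.
Proof. by move=> x; rewrite -[x]reprK quot_scaleE scale1r. Qed.

Lemma quot_scaleDr : right_distributive quot_scale +%R.
Proof.
move=> a x y; rewrite -[x]reprK -[y]reprK !quot_scaleE.
rewrite -[X in quot_scale a X](raddfD (\pi_quot_module)).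
rewrite quot_scaleE scalerDr.
exact: (raddfD (\pi_quot_module)).
Qed.

Lemma quot_scaleDl x : {morph quot_scale^~ x : a b / a + b}.
Proof.
move=> a b; rewrite -[x]reprK !quot_scaleE scalerDl.
exact: (raddfD (\pi_quot_module)).
Qed.

HB.instance Definition _ := GRing.Zmodule_isLmodule.Build R quot_module
  quot_scaleA quot_scale1 quot_scaleDr quot_scaleDl.

End QuotientModule.

(* M/IM as a module over the quotient ring R/I. *)
Section ReductionModulo.
Variables (R : comNzRingType) (I : idealr R) (M : lmodType R).

Local Notation IM := (pmul I (full M)).

Definition redmod : Type := quot_module IM.
HB.instance Definition _ := ZmodQuotient.copy redmod (quot_module IM).

Definition red_scale (a : {ideal_quot I}) (x : redmod) : redmod :=
  repr a *: (x : quot_module IM).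

Lemma red_scaleE (a : R) (x : redmod) :
  red_scale (\pi_({ideal_quot I}) a) x = a *: (x : quot_module IM).
Proof.
rewrite /red_scale; apply/eqP; rewrite -subr_eq0 -scalerBl.
have aI : repr (\pi_({ideal_quot I}) a) - a \in I.
  by rewrite Quotient.idealrBE reprK eqxx.
rewrite -[0](raddf0 (\pi_(quot_module IM))).
change (\pi_(quot_module IM) ((repr (\pi_({ideal_quot I}) a) - a) *: repr x)
  == \pi_(quot_module IM) 0).
rewrite -Quotient.idealrBE subr0; apply/asboolP.
exists [:: (repr (\pi_({ideal_quot I}) a) - a, repr x)]; last first.
  by rewrite big_seq1.
by move=> p; rewrite inE => /eqP->.
Qed.

Lemma red_scaleA a b x : red_scale a (red_scale b x) = red_scale (a * b) x.
Proof.
rewrite -[a]reprK -[b]reprK -rmorphM !red_scaleE.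
exact: scalerA.
Qed.

Lemma red_scale1 : left_id 1 red_scale.
Proof.
by move=> x; rewrite -[1](rmorph1 (\pi_({ideal_quot I}))) red_scaleE scale1r.
Qed.

Lemma red_scaleDr : right_distributive red_scale +%R.
Proof. by move=> a x y; rewrite -[a]reprK !red_scaleE; exact: scalerDr. Qed.

Lemma red_scaleDl x : {morph red_scale^~ x : a b / a + b}.
Proof.
move=> a b; rewrite -[a]reprK -[b]reprK.
rewrite -raddfD !red_scaleE.
exact: scalerDl.
Qed.

HB.instance Definition _ :=
  GRing.Zmodule_isLmodule.Build {ideal_quot I} redmod
    red_scaleA red_scale1 red_scaleDr red_scaleDl.

End ReductionModulo.

(* Free of finite rank; only applied to finite modules. *)
Definition free_module (A : nzRingType) (V : lmodType A) : Prop :=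
  exists (n : nat) (f : {linear 'rV[A]_n -> V}), bijective f.

(* A nonzero free direct summand of any rank contains one of finite nonzero
   rank. *)
Definition stable (R : comNzRingType) (M : lmodType R) : Prop :=
  forall (n : nat) (N : lmodType R) (f : {linear ('rV[R]_n * N)%type -> M}),
    bijective f -> n = 0%N.

Section Rings.
Variable R : comNzRingType.

(* The unit ideal, which is not an [idealr], is always finitely generated. *)
Definition noetherian : Prop :=
  forall I : idealr R, exists s : seq R, I =i pideal s.

Definition maximal_ideal (m : idealr R) : Prop :=
  forall J : idealr R, {subset m <= J} -> J =i m.

Definition local_ring (m : idealr R) : Prop :=
  maximal_ideal m /\ forall n : idealr R, maximal_ideal n -> n =i m.

Definition prime_chain (n : nat) : Prop :=
  exists p : nat -> prime_idealr R,
    forall i, (i < n)%N ->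
      {subset p i <= p i.+1} /\ ~ {subset p i.+1 <= p i}.

Definition krull_dim (d : nat) : Prop :=
  prime_chain d /\ forall n, prime_chain n -> (n <= d)%N.

Definition m_primary (m : idealr R) (S : {pred R}) : Prop :=
  (forall a b, a * b \in S -> a \in S \/ exists n, b ^+ n \in S) /\
  (forall a, a \in m <-> exists n, a ^+ n \in S).

Definition sop (m : idealr R) (s : seq R) : Prop :=
  [/\ krull_dim (size s), {subset s <= m} & m_primary m (pideal s)].

Definition parameter_ideal (m : idealr R) (S : {pred R}) : Prop :=
  exists2 s : seq R, sop m s & S =i pideal s.

Definition reduction (Q I : {pred R}) : Prop :=
  {subset Q <= I} /\
  exists r : nat, imul Q (ipow I r) =i ipow I r.+1.

Definition injective_module (E : lmodType R) : Prop :=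
  forall (A B : lmodType R) (f : {linear A -> B}) (g : {linear A -> E}),
    injective f -> exists h : {linear B -> E}, forall x, h (f x) = g x.

Definition finite_injdim (M : lmodType R) : Prop :=
  exists (n : nat) (E : nat -> lmodType R) (eta : {linear M -> E 0%N})
         (d : forall i, {linear E i -> E i.+1}),
    [/\ forall i, injective_module (E i),
        injective eta,
        forall x, d 0%N x = 0 <-> exists y, eta y = x,
        forall i x, d i.+1 x = 0 <-> exists y, d i y = x
      & forall i, (n < i)%N -> forall x : E i, x = 0].

Definition gorenstein_local (m : idealr R) : Prop :=
  [/\ noetherian, local_ring m & finite_injdim R^o].

End Rings.

Section Modules.
Variables (R : comNzRingType) (m : idealr R).
Implicit Type M : lmodType R.

(* The i-th element is a nonzerodivisor on M/(x_0,..,x_(i-1))M, and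
   M <> (x_0,..,x_(n-1))M. *)
Definition regular_seq M (s : seq R) : Prop :=
  (forall i, (i < size s)%N -> forall y : M,
     s`_i *: y \in pmul (pideal (take i s)) (full M) ->
     y \in pmul (pideal (take i s)) (full M)) /\
  (exists y : M, y \notin pmul (pideal s) (full M)).

(* No [n] is the depth of the zero module, whose depth is infinite. *)
Definition has_depth M (n : nat) : Prop :=
  (exists s, [/\ size s = n, {subset s <= m} & regular_seq M s]) /\
  (forall s, {subset s <= m} -> regular_seq M s -> (size s <= n)%N).

Definition max_CM M : Prop :=
  fin_gen M /\ exists2 d, krull_dim R d & has_depth M d.

Definition ulrich_module (Q : {pred R}) (I : idealr R) M : Prop :=
  [/\ max_CM M,
      pmul I (full M) =i pmul Q (full M)
    & free_module (redmod I M)].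

Definition ulrich_ideal (Q : {pred R}) (I : idealr R) : Prop :=
  ipow I 2 =i imul Q I /\ free_module (redmod I (ideal_module I)).

(* Finite free modules are the [vectType]s.  Minimality: the kernels of
   [pres_eps] and [pres_d] lie in m F_0 and m F_1. *)
Record min_presentation M := MinPresentation {
  pres_F1 : vectType R;
  pres_F0 : vectType R;
  pres_d : 'Hom(pres_F1, pres_F0);
  pres_eps : {linear pres_F0 -> M};
  pres_surj : forall y, exists x, pres_eps x = y;
  pres_exact : forall x, pres_eps x = 0 <-> exists y, pres_d y = x;
  pres_min0 : forall x, pres_eps x = 0 -> x \in pmul m (full pres_F0);
  pres_min1 : forall y, pres_d y = 0 -> y \in pmul m (full pres_F1)
}.

End Modules.

Section Dual.
Variables (R : comNzRingType) (F1 F0 : vectType R) (f : 'Hom(F1, F0)).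

Definition dual (g : 'Hom(F0, R^o)) : 'Hom(F1, R^o) := (g \o f)%VF.

Lemma dual_is_linear : linear dual.
Proof. by move=> a g h; rewrite /dual comp_lfunDl comp_lfunZl. Qed.

HB.instance Definition _ :=
  GRing.isLinear.Build R 'Hom(F0, R^o) 'Hom(F1, R^o) *:%R dual dual_is_linear.

End Dual.

Section TransposeSyzygy.
Variables (R : comNzRingType) (m : idealr R) (M : lmodType R).
Variable P : min_presentation m M.

Definition transpose : lmodType R := quot_module (image_pred (dual (pres_d P))).

Definition syzygy : lmodType R := submod_of (image_pred (pres_d P)).

End TransposeSyzygy.

(* lambda M = Omega (Tr M), computed from a minimal presentation of M and one
   of Tr M; it depends on these choices only up to isomorphism. *)
Definition lambda (R : comNzRingType) (m : idealr R) (M : lmodType R)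
    (P : min_presentation m M) (P' : min_presentation m (transpose P)) :
  lmodType R := syzygy P'.

(* Main.v *)
(** The ideal I is Ulrich but not a parameter ideal, so Q : I = I.  Let
    d : F1 -> F0 be the minimal presentation of M.  Then M = F0 / im d, and
    lambda M is isomorphic to the image of the dual of d, hence to F0^* / M^*,
    where M^* lies in m F0^* because M is stable.  For a submodule K of m F, a
    maximal Cohen-Macaulay module F / K is Ulrich iff K + Q F = I F.  The
    functionals on F0 mapping im d into Q form M^* + Q F0^*, and the vectors
    mapped into Q by M^* form im d + Q F0; since Q : I = I, the conditions
    im d + Q F0 = I F0 and M^* + Q F0^* = I F0^* are therefore equivalent.

    Both descriptions say that certain maps to R / Q lift to R.  They follow from
    the vanishing of Ext^i(M, R) and Ext^i(Tr M, R) for i > 0, once x is known to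
    be a regular sequence in R.  For the latter, injdim R >= d because M has depth
    d, and d terms are then too few for the Koszul complex of x, whose homology
    is m-torsion, to have homology in positive degree. *)

From HB Require Import structures.
Require Import Defs.
From mathcomp Require Import all_boot all_order all_algebra.
From mathcomp Require Import ring_quotient boolp functions.

Set Implicit Arguments.
Unset Strict Implicit.
Unset Printing Implicit Defensive.

Import GRing.Theory.

Local Open Scope ring_scope.
Local Open Scope quotient_scope.

Local Notation span := Defs.span.

(** * Submodules, quotients and finite modules *)

Section Modules.
Variable R : comNzRingType.
Implicit Types (M N U V W : lmodType R).

(** The equivalence rests on a pairing. If I F0 = im d + Q F0 and phi lies in M^* + Q F0^*, then phi
    maps I F0 into Q, so I phi(v) lies in Q and phi(v) in Q : I = I. Conversely, a functional with
    values in I maps im d, which lies in I F0, into I^2 and hence into Q; that it then lies in M^* +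
    Q F0^* is the lifting statement. The other implication exchanges vectors and functionals, with
    Tr M in place of M.

    Gorenstein means finite injective dimension here and d is the Krull dimension, so neither injdim
    R = d nor the regularity of x is given. The number e below is the last degree in which Ext into
    R is nonzero on some finite module; the residue field attains it, and e = d comes out together
    with the regularity of x. The vanishing for Tr M is not formal either: x is shown to be weakly
    regular on Tr M, and each of its e elements lowers the vanishing bound e + 1 by one. Ext occurs
    only through such vanishing statements; no Ext module is constructed. *)

Definition mklin U V (f : U -> V) (fl : linear f) : {linear U -> V} :=
  HB.pack f (GRing.isLinear.Build R U V *:%R f fl).

Lemma linP U V (f : U -> V) : linear f ->
  exists g : {linear U -> V}, forall x, g x = f x.
Proof. by move=> fl; exists (mklin fl). Qed.

Definition is_submod M (P : M -> Prop) :=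
  P 0 /\ forall a u v, P u -> P v -> P (a *: u + v).

Definition is_ideal (J : R -> Prop) := is_submod (M := R^o) J.

Section SubmodTheory.
Variables (M : lmodType R) (P : M -> Prop).
Hypothesis hP : is_submod P.

Lemma submod0 : P 0. Proof. by case: hP. Qed.

Lemma submodD u v : P u -> P v -> P (u + v).
Proof. by case: hP => _ h pu pv; rewrite -[u]scale1r; apply: h. Qed.

Lemma submodZ a u : P u -> P (a *: u).
Proof. by case: hP => h0 h pu; rewrite -[_ *: _]addr0; apply: h. Qed.

Lemma submodN u : P u -> P (- u).
Proof. by rewrite -scaleN1r; apply: submodZ. Qed.

Lemma submodB u v : P u -> P v -> P (u - v).
Proof. by move=> pu pv; apply: submodD => //; apply: submodN. Qed.

Lemma submod_sum I (r : seq I) (Q : pred I) (F : I -> M) :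
  (forall i, Q i -> P (F i)) -> P (\sum_(i <- r | Q i) F i).
Proof.
move=> h; elim/big_ind: _ => //; first exact: submod0.
exact: submodD.
Qed.

Lemma submod_closedP : submod_closed (fun x => `[<P x>]).
Proof.
split; first by apply/asboolP; exact: submod0.
by move=> a u v /asboolP pu /asboolP pv; apply/asboolP; case: hP => _; apply.
Qed.

Definition mksub : submodClosed M :=
  HB.pack (fun x => `[<P x>])
    (GRing.isSubmodClosed.Build R M (fun x => `[<P x>]) submod_closedP).

Lemma in_mksub x : (x \in mksub) <-> P x.
Proof. by split=> [/asboolP|?]; last apply/asboolP. Qed.

End SubmodTheory.

Lemma submod_ideal M (P : M -> Prop) u : is_submod P ->
  is_ideal (fun a => P (a *: u)).
Proof.
move=> hP; split=> [|a b c hb hc]; first by rewrite scale0r; exact: submod0.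
rewrite scalerDl -[a *: _]/(a * b) -scalerA.
by apply: submodD => //; apply: submodZ.
Qed.

Lemma is_idealMl (J : R -> Prop) a b : is_ideal J -> J b -> J (a * b).
Proof. by move=> hJ jb; apply: (submodZ hJ a jb). Qed.

Lemma is_idealMr (J : R -> Prop) a b : is_ideal J -> J a -> J (a * b).
Proof. by rewrite mulrC; apply: is_idealMl. Qed.

Lemma lin_image_submod U V (f : {linear U -> V}) (P : U -> Prop) :
  is_submod P -> is_submod (fun y => exists2 x, P x & f x = y).
Proof.
move=> hP; split; first by exists 0; rewrite ?linear0 //; exact: submod0.
move=> a _ _ [x px <-] [y py <-]; exists (a *: x + y); last by rewrite linearP.
by apply: submodD => //; apply: submodZ.
Qed.

Lemma image_submod U V (f : {linear U -> V}) : is_submod (fun y => exists x, f x = y).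
Proof.
split; first by exists 0; rewrite linear0.
by move=> a _ _ [x <-] [y <-]; exists (a *: x + y); rewrite linearP.
Qed.

Lemma preim_submod U V (f : {linear U -> V}) (P : V -> Prop) :
  is_submod P -> is_submod (fun x => P (f x)).
Proof.
move=> hP; split; first by rewrite linear0; exact: submod0.
by move=> a u v pu pv; rewrite linearP; apply: submodD => //; apply: submodZ.
Qed.

Lemma ker_submod U V (f : {linear U -> V}) : is_submod (fun x => f x = 0).
Proof.
split; first exact: linear0.
by move=> a u v pu pv; rewrite linearP pu pv scaler0 addr0.
Qed.

Lemma ann_ideal M (u : M) : is_ideal (fun a => a *: u = 0).
Proof.
apply: (submod_ideal (P := fun v : M => v = 0)); split=> // a v w -> ->.
by rewrite scaler0 addr0.
Qed.

(** Most later proofs see kernels, images and quotients only as abstract modules with a linear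
    injection or surjection, not as concrete subtypes and quotient types. *)
Lemma sub_exists M (P : M -> Prop) : is_submod P ->
  exists (N : lmodType R) (f : {linear N -> M}),
    injective f /\ forall x, P x <-> exists y, f y = x.
Proof.
move=> hP; pose S := mksub hP.
have vl : linear (fun x : submod_of S => val x) by move=> a u v.
exists (submod_of S), (mklin vl); split; first exact: val_inj.
move=> x; split=> [px|[y <-]].
  have xS : x \in S by apply/in_mksub.
  by exists (Sub x xS : submod_of S); exact: SubK.
by apply/(in_mksub hP); apply: valP.
Qed.

Lemma pi_eq0 M (S : submodClosed M) (x : M) :
  \pi_(quot_module S) x = 0 <-> x \in S.
Proof.
rewrite -[0](raddf0 (\pi_(quot_module S))) -[x in x \in S]subr0.
rewrite -[_ \in S]/(x - 0 \in zmod_pred S).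
by split=> [/eqP|h]; [|apply/eqP; move: h]; rewrite -Quotient.idealrBE.
Qed.

Lemma quot_exists M (P : M -> Prop) : is_submod P ->
  exists (N : lmodType R) (g : {linear M -> N}),
    (forall y, exists x, g x = y) /\ forall x, g x = 0 <-> P x.
Proof.
move=> hP; pose S := mksub hP.
have pl : linear (fun x => \pi_(quot_module S) x).
  move=> a u v; rewrite -[a *: \pi_(quot_module S) u]/(quot_scale a _).
  rewrite quot_scaleE; exact: raddfD.
exists (quot_module S), (mklin pl); split=> [y|x].
  by exists (repr y); rewrite /= reprK.
exact: iff_trans (pi_eq0 _ _) (in_mksub _ _).
Qed.

Lemma factor_surj U V W (g : {linear U -> V}) (f : {linear U -> W}) :
  (forall y, exists x, g x = y) -> (forall x, g x = 0 -> f x = 0) ->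
  exists h : {linear V -> W}, forall x, h (g x) = f x.
Proof.
move=> gs gf; have [s hs] := boolp.choice gs.
have key x y : g x = g y -> f x = f y.
  move=> e; apply/eqP; rewrite -subr_eq0 -linearB; apply/eqP/gf.
  by rewrite linearB e subrr.
have hl : linear (fun y => f (s y)).
  by move=> a u v; rewrite -linearP; apply: key; rewrite linearP !hs.
by exists (mklin hl) => x /=; apply: key.
Qed.

Lemma factor_inj U V W (f : {linear U -> V}) (g : {linear W -> V}) :
  injective f -> (forall x, exists y, f y = g x) ->
  exists h : {linear W -> U}, forall x, f (h x) = g x.
Proof.
move=> fi fg; have [s hs] := boolp.choice fg.
have hl : linear s by move=> a u v; apply: fi; rewrite !(linearP, hs).
by exists (mklin hl).
Qed.

Lemma row_hom V n (v : 'I_n -> V) :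
  exists f : {linear 'rV[R]_n -> V}, forall x, f x = \sum_i x 0 i *: v i.
Proof.
apply: (linP (f := fun x : 'rV[R]_n => \sum_i x 0 i *: v i)) => a x y.
rewrite scaler_sumr -big_split; apply: eq_bigr => i _ /=.
by rewrite !mxE scalerDl scalerA.
Qed.

Lemma row_homE V n (f : {linear 'rV[R]_n -> V}) x :
  f x = \sum_i x 0 i *: f (delta_mx 0 i).
Proof.
by rewrite {1}[x]row_sum_delta linear_sum; apply: eq_bigr => i _; rewrite linearZ.
Qed.

Lemma row_hom_compE V W n (p : {linear 'rV[R]_n -> V}) (h : {linear V -> W}) x :
  h (p x) = \sum_i x 0 i *: h (p (delta_mx 0 i)).
Proof. by rewrite row_homE linear_sum; apply: eq_bigr => i _; rewrite linearZ. Qed.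

Definition fg M := exists n (f : {linear 'rV[R]_n -> M}), forall y, exists x, f x = y.

Lemma spanP M (s : seq M) y :
  y \in span s <-> exists c : 'rV[R]_(size s), y = \sum_i c 0 i *: s`_i.
Proof.
split=> [/asboolP[c ->]|[c ->]].
  by exists (\row_i c i); apply: eq_bigr => i _; rewrite mxE.
apply/asboolP; exists (fun i => oapp (c 0) 0 (insub i)).
by apply: eq_bigr => i _; rewrite valK.
Qed.

Lemma span_submod M (s : seq M) : is_submod (fun y => y \in span s).
Proof.
split=> [|a u v /spanP[c ->] /spanP[e ->]]; apply/spanP.
  by exists 0; rewrite big1 // => i _; rewrite mxE scale0r.
exists (a *: c + e); rewrite scaler_sumr -big_split; apply: eq_bigr => i _ /=.
by rewrite !mxE scalerDl scalerA.
Qed.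

Lemma mem_span M (s : seq M) y : y \in s -> y \in span s.
Proof.
move=> ys; apply/spanP; have lt : (index y s < size s)%N by rewrite index_mem.
exists (delta_mx 0 (Ordinal lt)); rewrite (bigD1 (Ordinal lt)) //= big1 => [|i ne].
  by rewrite !mxE !eqxx scale1r nth_index ?addr0.
by rewrite mxE (negPf ne) andbF scale0r.
Qed.

Lemma span_sub M (s : seq M) (P : M -> Prop) : is_submod P ->
  (forall y, y \in s -> P y) -> forall y, y \in span s -> P y.
Proof.
move=> hP hs y /spanP[c ->]; apply: submod_sum => // i _; apply: submodZ => //.
by apply: hs; apply: mem_nth.
Qed.

Lemma mem_span_cons M (a : M) s y :
  y \in span (a :: s) <-> exists c, y - c *: a \in span s.
Proof.
split=> [/spanP[c ->]|[c hc]].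
  exists (c 0 ord0); rewrite big_ord_recl /= [_ *: _ + _]addrC addrK.
  apply/spanP; exists (\row_i c 0 (lift ord0 i)).
  by apply: eq_bigr => i _; rewrite mxE.
rewrite -(subrK (c *: a) y); have hS := span_submod (a :: s).
apply: (submodD hS); last by apply: (submodZ hS); apply: mem_span; rewrite mem_head.
apply: (span_sub hS) hc => z zs; apply: mem_span.
by rewrite in_cons zs orbT.
Qed.

Lemma fin_gen_fg M : fin_gen M <-> fg M.
Proof.
split=> [[s hs]|[n [f fs]]].
  have [f fE] := row_hom (fun i : 'I_(size s) => s`_i); exists (size s), f => y.
  by have /spanP[c ->] := hs y; exists c; rewrite fE.
exists [seq f (delta_mx 0 i) | i <- enum 'I_n] => y; have [x <-] := fs y.
have hS := span_submod [seq f (delta_mx 0 i) | i <- enum 'I_n].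
rewrite row_homE; apply: (submod_sum hS) => i _; apply: (submodZ hS).
by apply: mem_span; apply: map_f; rewrite mem_enum.
Qed.

Lemma fg_row n : fg 'rV[R]_n.
Proof. by exists n, idfun => y; exists y. Qed.

Lemma fg_ring : fg R^o.
Proof.
apply/fin_gen_fg; exists [:: 1] => y; apply/mem_span_cons; exists y.
by rewrite [y *: _]mulr1 subrr; exact: (submod0 (span_submod _)).
Qed.

Lemma fg_surj M N (f : {linear M -> N}) :
  (forall y, exists x, f x = y) -> fg M -> fg N.
Proof.
move=> fs [n [g gs]]; exists n, (f \o g) => y.
by have [x <-] := fs y; have [z <-] := gs x; exists z.
Qed.

Lemma mk_idealr (J : R -> Prop) : is_ideal J -> ~ J 1 ->
  exists I : idealr R, forall x, x \in I <-> J x.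
Proof.
move=> hJ J1; have cl : idealr_closed (fun x => `[<J x>] : bool).
  split; first by apply/asboolP; exact: (submod0 hJ).
    by apply/negP => /asboolP.
  move=> a u v /asboolP pu /asboolP pv; apply/asboolP.
  by apply: (submodD hJ) => //; apply: (submodZ hJ).
pose I : idealr R := HB.pack (fun x => `[<J x>] : bool) (isIdealr.Build R _ cl).
by exists I => x; split=> [/asboolP|?]; last apply/asboolP.
Qed.

Lemma idealr_ideal (I : idealr R) : is_ideal (fun a => a \in I).
Proof.
split=> [|a u v uI vI]; first exact: idealr0.
by apply: rpredD => //; apply: idealMr.
Qed.

Lemma pideal_ideal (s : seq R) : is_ideal (fun a => a \in pideal s).
Proof. exact: (span_submod (M := R^o) s). Qed.

End Modules.

Section Noetherian.
Variable R : comNzRingType.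
Hypothesis noethR : noetherian R.
Implicit Types (M N U V W : lmodType R) (J : R -> Prop).

Lemma noeth_fg J : is_ideal J -> exists s : seq R, forall x, J x <-> x \in pideal s.
Proof.
move=> hJ; have [J1|J1] := pselect (J 1).
  exists [:: 1] => x; split=> _; last first.
    by rewrite -[x]mulr1; apply: is_idealMl.
  rewrite -[x]mulr1; apply: (is_idealMl _ (pideal_ideal [:: 1])).
  by apply: (mem_span (M := R^o)); rewrite mem_head.
have [I hI] := mk_idealr hJ J1; have [s hs] := noethR I; exists s => x.
by rewrite -hI hs.
Qed.

(** A failure would give, by choice, a strictly ascending chain of ideals where [P] fails; the union
    is finitely generated, hence contained in a member of the chain. *)
Lemma noeth_ind (P : (R -> Prop) -> Prop) :
  (forall J, is_ideal J ->
     (forall J', is_ideal J' -> (forall x, J x -> J' x) ->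
        (exists x, J' x /\ ~ J x) -> P J') -> P J) ->
  forall J, is_ideal J -> P J.
Proof.
move=> step J0 hJ0; apply: contrapT => nP.
pose T := {J : R -> Prop | is_ideal J /\ ~ P J}.
have nxt (t : T) : exists t' : T, (forall x, sval t x -> sval t' x) /\
    exists x, sval t' x /\ ~ sval t x.
  case: t => J [hJ nPJ] /=; apply: contrapT => none; apply: nPJ; apply: step => //.
  move=> J' hJ' sub ne; apply: contrapT => nPJ'; apply: none.
  by exists (exist _ J' (conj hJ' nPJ')).
have [f hf] := boolp.choice nxt.
pose c n := iter n f (exist _ J0 (conj hJ0 nP)).
have cS n k x : sval (c n) x -> sval (c (k + n)%N) x.
  by elim: k => // k IH /IH h; rewrite addSn /=; apply: (hf _).1.
have cle n k x : (n <= k)%N -> sval (c n) x -> sval (c k) x.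
  by move=> le h; rewrite -(subnK le); apply: cS.
have hU : is_ideal (fun x => exists n, sval (c n) x).
  split; first by exists 0%N; exact: (submod0 hJ0).
  move=> a u v [n hn] [k hk]; exists (maxn n k).
  have hc := (svalP (c (maxn n k))).1.
  apply: (submodD hc); last by apply: cle hk; apply: leq_maxr.
  by apply: (submodZ hc); apply: cle hn; apply: leq_maxl.
have [s hs] := noeth_fg hU.
have bnd (r : seq R) : {subset r <= pideal s} ->
    exists n, forall y, y \in r -> sval (c n) y.
  elim: r => [|a r IH] sub; first by exists 0%N.
  have [y yr|n hn] := IH; first by apply: sub; rewrite inE yr orbT.
  have /hs[k hk] : a \in pideal s by apply: sub; rewrite mem_head.
  exists (maxn n k) => y; rewrite inE => /orP[/eqP->|/hn].
    by apply: cle hk; apply: leq_maxr.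
  by apply: cle; apply: leq_maxl.
have [y ys|n hn] := bnd s; first exact: (mem_span (M := R^o)).
have [x [h nh]] := (hf (c n)).2; apply: nh.
have /hs : exists k, sval (c k) x by exists n.+1.
exact: (span_sub (M := R^o) (svalP (c n)).1).
Qed.

Lemma noeth_max (S : (R -> Prop) -> Prop) J0 :
  (forall J, S J -> is_ideal J) -> S J0 ->
  exists2 J, S J & forall J', S J' -> (forall x, J x -> J' x) -> forall x, J' x -> J x.
Proof.
move=> Sid S0; apply: contrapT => none.
suff: forall J, is_ideal J -> ~ S J by move=> /(_ J0 (Sid _ S0)).
apply: noeth_ind => J hJ IH SJ; apply: none; exists J => // J' SJ' sub x J'x.
apply: contrapT => nJ; apply: (IH J' (Sid _ SJ') sub) => //.
by exists x.
Qed.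

(** Induction on [s]: the coefficients at the head [a] of elements of [P] form an ideal. Finitely
    many generators of it are lifted to [P]; after subtracting a combination of the lifts, an
    element of [P] lies in the span of the tail. *)
Lemma sub_fin M (s : seq M) (P : M -> Prop) : is_submod P ->
  exists2 t : seq M, (forall y, y \in t -> P y) &
    forall y, P y -> y \in span s -> y \in span t.
Proof.
elim: s P => [|a s IH] P hP.
  exists [::] => // y _ /spanP[c ->]; rewrite big_ord0.
(* The submodule is a parameter because [J] is used again for the span of the lifts [t1], to write
   every coefficient as that of an element of this span. *)
pose J (P' : M -> Prop) (r : R) := exists2 y, P' y & y - r *: a \in span s.
have hS := span_submod s.
have hJ P' : is_submod P' -> is_ideal (J P').
  move=> hP'; split.
    by exists 0; [exact: submod0|rewrite scale0r subr0; exact: (submod0 hS)].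
  move=> r u v [y py ys] [z pz zs]; exists (r *: y + z).
    by apply: submodD => //; apply: submodZ.
  rewrite scalerDl -[r *: u]/(r * u) -scalerA opprD addrACA -scalerBr.
  by apply: (submodD hS) => //; apply: (submodZ hS).
have [js hjs] := noeth_fg (hJ P hP).
have lifts : exists2 t : seq M, (forall y, y \in t -> P y) &
    forall r, r \in js -> exists2 y, y \in span t & y - r *: a \in span s.
  have : forall r, r \in js -> J P r.
    by move=> r rs; apply/hjs; exact: (mem_span (M := R^o)).
  elim: js {hjs} => [|r js IHj] hr; first by exists [::].
  have [y py yr] := hr r (mem_head _ _).
  have [r' r'j|t tP ht] := IHj; first by apply: hr; rewrite inE r'j orbT.
  exists (y :: t) => [z|r']; rewrite inE => /orP[/eqP->//|]; first exact: tP.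
    by exists y => //; apply: mem_span; rewrite mem_head.
  move=> /ht[z zt zs]; exists z => //.
  apply: (span_sub (span_submod (y :: t))) zt => w wt; apply: mem_span.
  by rewrite inE wt orbT.
have [t1 t1P ht1] := lifts; have [t2 t2P ht2] := IH P hP.
have hT := span_submod (t1 ++ t2).
have sub1 z : z \in span t1 -> z \in span (t1 ++ t2).
  by apply: (span_sub hT) => w wt; apply: mem_span; rewrite mem_cat wt.
have sub2 z : z \in span t2 -> z \in span (t1 ++ t2).
  by apply: (span_sub hT) => w wt; apply: mem_span; rewrite mem_cat wt orbT.
exists (t1 ++ t2) => [y|y py /mem_span_cons[r yr]].
  by rewrite mem_cat => /orP[/t1P|/t2P].
have Jr : J P r by exists y.
have [z zt zr] : exists2 z, z \in span t1 & z - r *: a \in span s.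
  apply: (span_sub (M := R^o) (hJ _ (span_submod t1)) ht1); exact/hjs.
rewrite -(subrK z y); apply: (submodD hT); last exact: sub1.
apply: sub2; apply: ht2.
  by apply: submodB => //; apply: (span_sub hP t1P).
have -> : y - z = (y - r *: a) - (z - r *: a) by rewrite opprB addrA subrK.
exact: (submodB hS).
Qed.

Lemma fg_sub M N (f : {linear N -> M}) : injective f -> fg M -> fg N.
Proof.
move=> fi /fin_gen_fg[s hs].
have [t tP ht] := sub_fin s (image_submod f).
have: exists2 u : seq N, t = map f u & True.
  elim: t tP {ht} => [|y t IH] tP; first by exists [::].
  have [x xE] := tP y (mem_head _ _).
  have [z zt|u -> _] := IH; first by apply: tP; rewrite inE zt orbT.
  by exists (x :: u); rewrite //= xE.
move=> [u tE _]; apply/fin_gen_fg; exists u => y.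
have /asboolP[c] : f y \in span t by apply: ht => //; exists y.
rewrite tE size_map => e; apply/asboolP; exists c; apply: fi.
rewrite e linear_sum; apply: eq_bigr => i _.
by rewrite linearZ (nth_map 0).
Qed.

End Noetherian.

(** * Regular sequences *)

Section Multiples.
Variable R : comNzRingType.
Implicit Types (M N U V W : lmodType R) (x : seq R).

Lemma mem_pmul M (S : {pred R}) a (u : M) : a \in S -> a *: u \in pmul S (full M).
Proof.
move=> aS; apply/asboolP; exists [:: (a, u)]; last by rewrite big_seq1.
by move=> p; rewrite inE => /eqP->.
Qed.

Lemma pmul_sub M (S : {pred R}) (P : M -> Prop) : is_submod P ->
  (forall a u, a \in S -> P (a *: u)) -> forall y, y \in pmul S (full M) -> P y.
Proof.
move=> hP hS y /asboolP[s hs ->]; rewrite big_seq.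
by apply: submod_sum => // p /hs[p1 _]; apply: hS.
Qed.

Lemma pmul_submod M (I : idealr R) : is_submod (fun y => y \in pmul I (full M)).
Proof. by case: (@pmul_submod_closed R M I (full M)). Qed.

(* The submodule (x_0, .., x_(j-1)) M, also when these elements generate the unit
   ideal, which is not an [idealr]. *)
Fixpoint qmul M x (j : nat) (y : M) : Prop :=
  if j is i.+1 then exists u, qmul x i (y - x`_i *: u) else y = 0.

Lemma qmul_submod M x j : is_submod (@qmul M x j).
Proof.
elim: j => [|j IH] /=; first by split=> // a u v -> ->; rewrite scaler0 addr0.
split; first by exists 0; rewrite scaler0 subr0; exact: (submod0 IH).
move=> a u v [u' hu] [v' hv]; exists (a *: u' + v').
rewrite scalerDr scalerA [x`_j * a]mulrC -scalerA opprD addrACA -scalerBr.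
by apply: (submodD IH) => //; apply: (submodZ IH).
Qed.

Lemma qmulS M x j (y : M) : qmul x j y -> qmul x j.+1 y.
Proof. by exists 0; rewrite scaler0 subr0. Qed.

Lemma qmul_le M x i j (y : M) : (i <= j)%N -> qmul x i y -> qmul x j y.
Proof.
move=> le h; rewrite -(subnK le); elim: (j - i)%N => // k.
exact: qmulS.
Qed.

Lemma mem_qmul M x i j (u : M) : (i < j)%N -> qmul x j (x`_i *: u).
Proof.
move=> lt; apply: (qmul_le lt); exists u; rewrite subrr.
exact: (submod0 (qmul_submod M x i)).
Qed.

Lemma qmul_min M x j (P : M -> Prop) : is_submod P ->
  (forall i u, (i < j)%N -> P (x`_i *: u)) -> forall y, qmul x j y -> P y.
Proof.
move=> hP; elim: j => [|j IH] hx y /=; first by move->; exact: submod0.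
move=> [u hu]; rewrite -(subrK (x`_j *: u) y); apply: submodD => //; last exact: hx.
by apply: IH hu => i v lt; apply: hx; apply: leqW.
Qed.

Lemma qmul_lin M N (f : {linear M -> N}) x j y : qmul x j y -> qmul x j (f y).
Proof.
elim: j y => [|j IH] y /=; first by move->; rewrite linear0.
by move=> [u /IH hu]; exists (f u); rewrite linearB linearZ in hu.
Qed.

Lemma qmul_lift M N (f : {linear M -> N}) x j z : (forall y, exists u, f u = y) ->
  qmul x j z -> exists2 y, qmul x j y & f y = z.
Proof.
move=> fs; elim: j z => [|j IH] z /=; first by move->; exists 0; rewrite ?linear0.
move=> [u /IH[y qy yE]]; have [v vE] := fs u; exists (y + x`_j *: v).
  by exists v; rewrite addrK.
by rewrite linearD linearZ vE yE subrK.
Qed.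

Lemma qmulZ M x j a (u : M) : qmul (M := R^o) x j a -> qmul x j (a *: u).
Proof.
move: a; apply: (qmul_min (M := R^o)); first exact: submod_ideal (qmul_submod _ _ _).
move=> i b lt; rewrite -[x`_i *: _]/(x`_i * b) -scalerA.
exact: mem_qmul.
Qed.

Lemma qmulE M x j (y : M) : (j <= size x)%N ->
  qmul x j y <-> y \in pmul (pideal (take j x)) (full M).
Proof.
move=> le; have nthT i : (i < j)%N -> x`_i \in take j x.
  move=> lt; rewrite -(nth_take _ lt); apply: mem_nth.
  by rewrite size_take_min (minn_idPl le).
split=> [|yp].
  suff: forall k, (k <= j)%N -> forall z : M, qmul x k z ->
      z \in pmul (pideal (take j x)) (full M) by apply.
  elim=> [|k IH] lek z /=.
    by move->; apply/asboolP; exists [::]; rewrite ?big_nil.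
  move=> [u /(IH (ltnW lek))/asboolP[s hs zE]]; apply/asboolP.
  exists ((x`_k, u) :: s); last by rewrite big_cons -zE addrC subrK.
  move=> p; rewrite inE => /orP[/eqP->|/hs//]; split=> //.
  by apply: (mem_span (M := R^o)); exact: nthT.
apply: (pmul_sub (qmul_submod M x j)) yp => a u ap; apply: qmulZ; move: a ap.
apply: (span_sub (M := R^o)); first exact: qmul_submod.
move=> a /(nthP 0)[i]; rewrite size_take_min (minn_idPl le) => lt <-.
rewrite nth_take // -[x`_i]mulr1; exact: (mem_qmul (M := R^o)).
Qed.

Lemma qmul_ideal x a : qmul (M := R^o) x (size x) a <-> a \in pideal x.
Proof.
rewrite qmulE // take_size; split=> [|ap]; last first.
  by rewrite -[a]mulr1; apply: (mem_pmul (M := R^o)).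
apply: (pmul_sub (M := R^o) (pideal_ideal x)) => b u bp.
exact: (is_idealMr _ (pideal_ideal x)).
Qed.

(** Weak regularity: M <> (x) M is not demanded, so the notion applies to modules not known to be
    nonzero, such as Tr M. *)
Definition wreg M x n :=
  forall i, (i < n)%N -> forall y : M, qmul x i (x`_i *: y) -> qmul x i y.

Lemma regular_seqP M x : regular_seq M x <->
  wreg M x (size x) /\ exists y : M, ~ qmul x (size x) y.
Proof.
split=> -[hr [y hy]]; split.
- move=> i lt z h; apply/(qmulE _ (ltnW lt)); apply: hr => //.
  by apply/(qmulE _ (ltnW lt)).
- by exists y => /(qmulE _ (leqnn _)); rewrite take_size; apply/negP.
- move=> i lt z /(qmulE _ (ltnW lt)) h; apply/(qmulE _ (ltnW lt)).
  exact: hr.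
- by exists y; apply/negP => h; apply: hy; apply/qmulE => //; rewrite take_size.
Qed.

(** Regularity puts the last coefficient into the ideal of the earlier elements. Expanding it there
    and moving the terms [x_n g_i] into the other coefficients shortens the relation. *)
Lemma wreg_relation x n (c : nat -> R) : wreg R^o x n ->
  \sum_(i < n) c i * x`_i = 0 -> forall i, (i < n)%N -> qmul (M := R^o) x n (c i).
Proof.
move=> hr; elim: n hr c => [//|n IH] hr c.
have hr' : wreg R^o x n by move=> i lt; apply: hr; apply: leqW.
rewrite big_ord_recr /= => e0.
have: qmul (M := R^o) x n (c n).
  apply: hr => //; rewrite -[_ *: _]/(x`_n * c n) mulrC.
  move/eqP: e0; rewrite addrC addr_eq0 => /eqP->.
  apply: (submodN (qmul_submod R^o x n)).
  apply: (submod_sum (qmul_submod R^o x n)) => i _.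
  by rewrite mulrC; apply: (mem_qmul (M := R^o)).
have coef k z : qmul (M := R^o) x k z ->
    exists g : nat -> R, z = \sum_(i < k) g i * x`_i.
  elim: k z => [|k IHk] z /=; first by move->; exists (fun=> 0); rewrite big_ord0.
  move=> [u /IHk[g gE]]; exists (fun i => if i == k then u else g i).
  rewrite big_ord_recr /= eqxx -[z in LHS](subrK (x`_k *: (u : R^o))) gE.
  congr (_ + _); last by rewrite mulrC.
  by apply: eq_bigr => i _; rewrite ltn_eqF.
move=> cn; have [g gE] := coef _ _ cn.
have {}e0 : \sum_(i < n) (c i + x`_n * g i) * x`_i = 0.
  rewrite -[RHS]e0 gE mulr_suml -big_split; apply: eq_bigr => i _ /=.
  by rewrite mulrDl; congr (_ + _); rewrite -mulrA mulrC.
move=> i; rewrite ltnS leq_eqVlt => /orP[/eqP->|lt]; first exact: qmulS.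
exists (- g i : R^o); rewrite scalerN opprK.
exact: (IH hr' (fun i => c i + x`_n * g i)).
Qed.

End Multiples.

(** * Noetherian local rings *)

Section Local.
Variables (R : comNzRingType) (m : idealr R).
Hypotheses (noethR : noetherian R) (locR : local_ring m).
Implicit Types (M N U V W : lmodType R) (x : seq R) (p : R -> Prop).

Lemma principal_ideal (a : R) : is_ideal (fun b => exists c, b = c * a).
Proof.
split; first by exists 0; rewrite mul0r.
move=> b _ _ [c ->] [e ->]; exists (b * c + e).
by rewrite mulrDl -mulrA.
Qed.

Lemma ideal_sub_m J : is_ideal J -> ~ J 1 -> forall a, J a -> a \in m.
Proof.
move=> hJ J1 a Ja.
pose S K := [/\ is_ideal K, ~ K 1 & forall b, J b -> K b].
have [K [hK K1 JK] Kmax] : exists2 K, S K &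
    forall K', S K' -> (forall b, K b -> K' b) -> forall b, K' b -> K b.
  by apply: (noeth_max noethR (J0 := J)); [move=> K []|split].
have [n hn] := mk_idealr hK K1.
have nmax : maximal_ideal n.
  move=> L nL b; apply/idP/idP; last exact: nL.
  move=> Lb; apply/hn; apply: (Kmax (fun c => c \in L)) Lb.
    split; first exact: idealr_ideal.
      by rewrite idealr1.
    by move=> c /JK/hn/nL.
  by move=> c /hn/nL.
by rewrite -(locR.2 n nmax); apply/hn/JK.
Qed.

Lemma local_unit a : a \notin m -> exists b, b * a = 1.
Proof.
move=> am; apply: contrapT => none; move: am; apply/negP/negPn.
apply: (ideal_sub_m (principal_ideal a)); last by exists 1; rewrite mul1r.
by move=> [b e]; apply: none; exists b.
Qed.

Lemma local_prime a b : a * b \in m -> a \in m \/ b \in m.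
Proof.
move=> abm; have [am|am] := boolP (a \in m); [by left|right].
have [c e] := local_unit am; rewrite -[b]mul1r -e -mulrA.
exact: idealMr.
Qed.

(** The determinant is 1 modulo m, hence a unit, and the adjugate gives the inverse. All forms of
    Nakayama's lemma below rest on this. *)
Lemma inv_1Bmx n (C : 'M[R]_n) : (forall i j, C i j \in m) ->
  exists2 B : 'M[R]_n, B *m (1%:M - C) = 1%:M & (1%:M - C) *m B = 1%:M.
Proof.
move=> hC; set D := 1%:M - C.
pose f : {rmorphism R -> {ideal_quot m}} := \pi_({ideal_quot m}).
have f0 a : a \in m -> f a = 0.
  move=> am; rewrite -(rmorph0 f); apply/eqP.
  by rewrite -[_ == _]/(a == 0 %[mod {ideal_quot m}]) -Quotient.idealrBE subr0.
have : \det D \notin m.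
  apply/negP => /f0; rewrite -det_map_mx; have -> : map_mx f D = 1%:M.
    by apply/matrixP => i j; rewrite !mxE rmorphB rmorph_nat f0 ?subr0.
  by rewrite det1 => /eqP; rewrite oner_eq0.
move=> /local_unit[b bD]; exists (b *: \adj D).
  by rewrite -scalemxAl mul_adj_mx scale_scalar_mx bD.
by rewrite -scalemxAr mul_mx_adj scale_scalar_mx bD.
Qed.

(** [V] need not be finitely generated: for Ext it is the module of all functions from N into an
    injective module, and [v] a family of cocycles. *)
Lemma nakayama_family V g (v : 'I_g -> V) (P : V -> Prop) : is_submod P ->
  (forall i, exists c : 'rV[R]_g,
     (forall j, c 0 j \in m) /\ P (v i - \sum_j c 0 j *: v j)) ->
  forall i, P (v i).
Proof.
move=> hP /boolp.choice[c hc].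
pose C := \matrix_(i, j) c i 0 j.
have [|B BD _] := @inv_1Bmx _ C; first by move=> i j; rewrite mxE; apply: (hc i).1.
move=> k; have -> : v k = \sum_i B k i *: (v i - \sum_j C i j *: v j).
  have dE i : v i - \sum_j C i j *: v j = \sum_j (1%:M - C) i j *: v j.
    under [RHS]eq_bigr do rewrite !mxE scalerBl.
    rewrite sumrB [in RHS](bigD1 i) //= eqxx scale1r.
    rewrite [X in _ = _ + X - _]big1 ?addr0; last first.
      by move=> j; rewrite eq_sym => /negPf->; rewrite scale0r.
    by congr (_ - _); apply: eq_bigr => j _; rewrite mxE.
  under eq_bigr do rewrite dE scaler_sumr; rewrite exchange_big /=.
  under eq_bigr do (under eq_bigr do rewrite scalerA; rewrite -scaler_suml).
  transitivity (\sum_j (1%:M : 'M[R]_g) k j *: v j).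
    rewrite (bigD1 k) //= mxE eqxx scale1r big1 ?addr0 // => j.
    by rewrite mxE eq_sym => /negPf->; rewrite scale0r.
  apply: eq_bigr => j _; congr (_ *: _).
  by have := congr1 (fun X : 'M_g => X k j) BD; rewrite mxE => ->.
apply: submod_sum => // i _; apply: submodZ => //.
by under eq_bigr do rewrite mxE; apply: (hc i).2.
Qed.

Lemma nakayama N (P : N -> Prop) : fg N -> is_submod P ->
  (forall y, exists2 z, z \in pmul m (full N) & P (y - z)) -> forall y, P y.
Proof.
move=> [g [f fs]] hP h y; have [c <-] := fs y.
rewrite row_homE; apply: submod_sum => // i _; apply: submodZ => //.
move: i {c}; apply: nakayama_family => // i.
have [z zm Pz] := h (f (delta_mx 0 i)).
suff [c [cm zE]] : exists c : 'rV[R]_g, (forall j, c 0 j \in m) /\ z = f c.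
  by exists c; rewrite -row_homE -zE.
move: z zm {Pz}; apply: pmul_sub.
  split; first by exists 0; rewrite linear0; split=> // j; rewrite mxE rpred0.
  move=> a _ _ [c [cm ->]] [e [em ->]]; exists (a *: c + e); rewrite linearP.
  by split=> // j; rewrite !mxE rpredD // idealMr.
move=> a u am; have [w <-] := fs u; exists (a *: w); rewrite linearZ.
by split=> // j; rewrite mxE mulrC idealMr.
Qed.

Lemma nakayama1 N (P : N -> Prop) a : fg N -> a \in m -> is_submod P ->
  (forall y, exists z, P (y - a *: z)) -> forall y, P y.
Proof.
move=> fgN am hP h; apply: nakayama => // y; have [z hz] := h y.
by exists (a *: z) => //; apply: mem_pmul.
Qed.

Definition is_prime p :=
  [/\ is_ideal p, ~ p 1 & forall a b, p (a * b) -> p a \/ p b].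

Lemma prime_m : is_prime (fun a => a \in m).
Proof.
split; [exact: idealr_ideal|by rewrite idealr1|exact: local_prime].
Qed.

(** An associated prime inside [p]: a maximal one among the annihilators, contained in [p], of
    multiples [c *: z] modulo [P]. Let ab kill cz. If the annihilator of acz still lies in [p],
    maximality puts b into that of cz. Otherwise some e outside [p] kills acz; the annihilator of
    ecz lies in [p] because [p] is prime, and maximality puts a into that of cz. *)
Lemma max_ann V (P : V -> Prop) (z : V) p : is_submod P -> is_prime p ->
  (forall a, P (a *: z) -> p a) ->
  exists2 c, is_prime (fun a => P (a *: (c *: z))) &
    forall a, P (a *: (c *: z)) -> p a.
Proof.
move=> hP [hp p1 pM] hz.
pose S J := exists2 c, (forall a, P (a *: (c *: z)) -> p a) &
  J = (fun a => P (a *: (c *: z))).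
have S0 : S (fun a => P (a *: (1 *: z))).
  by exists 1 => // a; rewrite scale1r; apply: hz.
have [] := noeth_max noethR (S := S) _ S0.
  by move=> J [c _ ->]; apply: submod_ideal.
move=> J [c hc ->] cmax; exists c => //; split; first exact: submod_ideal.
  by move=> h1; apply: p1; apply: hc.
move=> a b Pab; have [|na] := pselect (forall e, P (e *: (a *: (c *: z))) -> p e).
  move=> ha; right; apply: (cmax (fun e => P (e *: ((a * c) *: z)))).
  - by exists (a * c) => // e; rewrite -[(a * c) *: z]scalerA; apply: ha.
  - by move=> e Pe; rewrite -scalerA scalerA mulrC -scalerA; apply: submodZ.
  - by rewrite -scalerA scalerA mulrC.
left; have [e [Pe pe]] : exists e, P (e *: (a *: (c *: z))) /\ ~ p e.
  apply: contrapT => none; apply: na => e Pe; apply: contrapT => pe.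
  by apply: none; exists e.
apply: (cmax (fun f => P (f *: ((e * c) *: z)))); last 1 first.
- by rewrite -scalerA scalerA mulrC -scalerA.
- exists (e * c) => // f; rewrite -scalerA scalerA => /hc/pM[]//.
- by move=> f Pf; rewrite -scalerA scalerA mulrC -scalerA; apply: submodZ.
Qed.

Definition pchain n p := exists q : nat -> R -> Prop,
  [/\ forall i, is_prime (q i), q n = p &
      forall i, (i < n)%N ->
        (forall a, q i a -> q i.+1 a) /\ exists a, q i.+1 a /\ ~ q i a].

Lemma pchain0 p : is_prime p -> pchain 0 p.
Proof. by exists (fun=> p). Qed.

Lemma pchainS n p p' : pchain n p -> is_prime p' ->
  (forall a, p a -> p' a) -> (exists a, p' a /\ ~ p a) -> pchain n.+1 p'.
Proof.
move=> [q [qp qn qc]] hp' sub ne; exists (fun i => if (i <= n)%N then q i else p').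
split=> [i||i]; first by case: ifP.
  by rewrite ltnn.
rewrite ltnS => le; rewrite le; have [lt|ge] := ltnP i n; first exact: qc.
have -> : i = n by apply/eqP; rewrite eqn_leq le.
by rewrite qn.
Qed.

Lemma pchain_prime_chain n p : pchain n p -> prime_chain R n.
Proof.
move=> [q [qp qn qc]].
have mk i : exists P : prime_idealr R, forall a, a \in P <-> q i a.
  have [hq q1 qM] := qp i.
  have cl : idealr_closed (fun a => `[<q i a>] : bool).
    split; first by apply/asboolP; exact: (submod0 hq).
      by apply/negP => /asboolP.
    move=> a u v /asboolP pu /asboolP pv; apply/asboolP.
    by apply: (submodD hq) => //; apply: (submodZ hq).
  have pc : prime_idealr_closed (fun a => `[<q i a>] : bool).
    by move=> u v /asboolP/qM[h|h]; apply/orP; [left|right]; apply/asboolP.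
  pose P : prime_idealr R := HB.pack (fun a => `[<q i a>] : bool)
    (isIdealr.Build R _ cl) (isPrimeIdealrClosed.Build R _ pc).
  by exists P => a; split=> [/asboolP|?]; last apply/asboolP.
have [P hP] := boolp.choice mk; exists P => i /qc[sub [a [qa nqa]]].
split=> [b|sub']; first by move=> /hP/sub/hP.
by apply: nqa; apply/hP; apply: sub'; apply/hP.
Qed.

(** Each element of the sequence adds one prime: x_n lies in [p], but being regular it avoids the
    associated prime of M / (x_0, .., x_(n-1)) M found inside [p]. *)
Lemma wreg_pchain M x n (z : M) p : wreg M x n -> is_prime p ->
  (forall a, qmul x n (a *: z) -> p a) -> pchain n p.
Proof.
elim: n z p => [|n IH] z p hr hp hz; first exact: pchain0.
have hn a : qmul x n (a *: z) -> p a by move=> h; apply: hz; apply: qmulS.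
have [c cp cz] := max_ann (qmul_submod M x n) hp hn.
apply: (pchainS _ hp cz).
  by apply: (IH (c *: z)) => // i lt; apply: hr; apply: leqW.
exists x`_n; split; first by apply: hz; apply: mem_qmul.
by move=> /(hr n (leqnn _)); rewrite -[c *: z]scale1r; case: cp.
Qed.

Lemma ann_in_m M (P : M -> Prop) z a : is_submod P -> ~ P z -> P (a *: z) -> a \in m.
Proof.
move=> hP nz; apply: (@ideal_sub_m (fun a => P (a *: z))); first exact: submod_ideal.
by rewrite scale1r.
Qed.

Lemma depth_le_dim M x n : wreg M x n -> (exists y : M, ~ qmul x n y) ->
  prime_chain R n.
Proof.
move=> hr [y hy]; apply: (@pchain_prime_chain _ (fun a => a \in m)).
apply: (wreg_pchain (z := y) hr prime_m) => a.
exact: (ann_in_m (qmul_submod M x n) hy).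
Qed.

(** The associated prime of M / (x_0, .., x_(n-1)) M inside m ends a chain of length n. Were it not
    m, appending m would exceed the dimension. *)
Lemma max_depth_socle M x n : wreg M x n -> (exists y : M, ~ qmul x n y) ->
  (forall k, prime_chain R k -> (k <= n)%N) ->
  exists z : M, forall a, qmul x n (a *: z) <-> a \in m.
Proof.
move=> hr [y hy] dim.
have [c cp cz] := max_ann (qmul_submod M x n) prime_m
  (fun a => ann_in_m (a := a) (qmul_submod M x n) hy).
exists (c *: y) => a; split; first exact: cz.
move=> am; apply: contrapT => na; suff: prime_chain R n.+1 by move=> /dim; rewrite ltnn.
apply: (@pchain_prime_chain _ (fun a => a \in m)).
have ch : pchain n (fun a => qmul x n (a *: (c *: y))).
  by apply: (wreg_pchain (z := c *: y) hr cp).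
by apply: (pchainS ch prime_m cz); exists a.
Qed.

(** The prime annihilator of a suitable multiple contains [S], hence every element with a power in
    [S], hence m. *)
Lemma torsion_socle M (P : M -> Prop) z (S : {pred R}) : is_submod P -> ~ P z ->
  m_primary m S -> (forall a, a \in S -> P (a *: z)) ->
  exists c, forall a, P (a *: (c *: z)) <-> a \in m.
Proof.
move=> hP nz [_ prim] hS.
have [c cp cz] := max_ann hP prime_m (fun a => ann_in_m (a := a) hP nz).
exists c => a; split; first exact: cz.
move=> /prim[n /hS h]; have {h} : P (a ^+ n *: (c *: z)).
  by rewrite scalerA mulrC -scalerA; apply: submodZ.
case: cp => _ p1 pM; elim: n => [|n IH]; first by move/p1.
by rewrite exprS => /pM[|/IH].
Qed.

End Local.

(** * Ext into R *)

Definition ses (R : comNzRingType) (A B C : lmodType R)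
    (f : {linear A -> B}) (g : {linear B -> C}) :=
  [/\ injective f, forall c, exists b, g b = c &
      forall b, g b = 0 <-> exists a, f a = b].

(* An injective resolution [res_mod 1 -> res_mod 2 -> ..] of R, shifted so that
   [res_mod 0 = 0]: cocycles modulo coboundaries then have the same shape in
   every degree. *)
Record injres (R : comNzRingType) := InjRes {
  res_mod :> nat -> lmodType R;
  res_d : forall i, {linear res_mod i -> res_mod i.+1};
  res_eta : {linear R^o -> res_mod 1%N};
  res_inj : forall i, injective_module (res_mod i);
  res_0 : forall x : res_mod 0%N, x = 0;
  res_eta_inj : injective res_eta;
  res_exact0 : forall x, res_d 1%N x = 0 <-> exists y, res_eta y = x;
  res_exact : forall i x, res_d i.+2 x = 0 <-> exists y, res_d i.+1 y = x
}.

Lemma finite_injdim_injres (R : comNzRingType) : finite_injdim (R^o) ->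
  exists (E : injres R) (n : nat), forall i, (n < i)%N -> forall x : E i, x = 0.
Proof.
move=> [n [E [eta [d [Einj etai ex0 exS fin]]]]].
pose E' i : lmodType R := if i is j.+1 then E j else 'rV[R]_0.
pose d' i : {linear E' i -> E' i.+1} :=
  match i return {linear E' i -> E' i.+1} with
  | 0 => \0 : {linear 'rV[R]_0 -> E 0%N} | j.+1 => d j end.
have E0 (x : E' 0%N) : x = 0 by apply: thinmx0.
have Einj' i : injective_module (E' i).
  case: i => [|i]; last exact: Einj.
  by move=> A B f g _; exists \0 => a; apply/esym; apply: thinmx0.
exists (@InjRes R E' d' eta Einj' E0 etai ex0 exS), n.+1.
by case=> // i lt x; apply: fin.
Qed.

Section Ext.
Variables (R : comNzRingType) (E : injres R).
Implicit Types (A B C M N : lmodType R).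
Local Notation d := (@res_d R E _).

Lemma res_dd i (x : E i) : d (d x) = 0.
Proof.
case: i x => [|i] x; first by rewrite (res_0 x) !linear0.
by apply/res_exact; exists x.
Qed.

Definition cocycle i N (phi : {linear N -> E i.+1}) := forall x, d (phi x) = 0.

(* Vanishing of Ext^i(N, R). *)
Definition ext0 i N := forall phi : {linear N -> E i.+1}, cocycle phi ->
  exists psi : {linear N -> E i}, forall x, phi x = d (psi x).

Lemma ext_trivial i N : (forall x : N, x = 0) -> ext0 i N.
Proof. by move=> h phi _; exists \0 => x; rewrite (h x) !linear0. Qed.

Lemma ext_free i n : ext0 i.+1 'rV[R]_n.
Proof.
move=> phi hphi.
have /boolp.choice[u hu] (k : 'I_n) : exists u, d u = phi (delta_mx 0 k).
  exact/res_exact.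
have [psi psiE] := row_hom u; exists psi => x.
rewrite psiE row_homE linear_sum; apply: eq_bigr => k _.
by rewrite linearZ hu.
Qed.

Lemma ext_retract i M N (h : {linear M -> N}) (h' : {linear N -> M}) :
  (forall x, h' (h x) = x) -> ext0 i N -> ext0 i M.
Proof.
move=> hK hN phi hphi; have [|psi psiE] := hN (phi \o h'); first by move=> x /=.
by exists (psi \o h) => x; rewrite -psiE /= hK.
Qed.

Section LongExactSequence.
Variables (A B C : lmodType R) (f : {linear A -> B}) (g : {linear B -> C}).
Hypothesis fg_ses : ses f g.

Let gf x : g (f x) = 0.
Proof. by case: fg_ses => _ _ ex; apply/ex; exists x. Qed.

Let ker_factor (V : lmodType R) (phi : {linear B -> V}) : (forall x, phi (f x) = 0) ->
  exists h : {linear C -> V}, forall x, h (g x) = phi x.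
Proof.
case: fg_ses => _ gs ex h; apply: factor_surj => // x /ex[a <-].
exact: h.
Qed.

(** Surjectivity of Ext^i(B, R) -> Ext^i(A, R), for cocycles themselves: extend [phi] by
    injectivity, note that the coboundary of the extension descends to C, where it bounds, and
    correct by that. *)
Lemma ext_lift i (phi : {linear A -> E i.+1}) : ext0 i.+1 C -> cocycle phi ->
  exists2 psi : {linear B -> E i.+1}, cocycle psi & forall x, psi (f x) = phi x.
Proof.
case: fg_ses => fi gs _ hC hphi.
have [phi' phi'E] := res_inj phi fi.
have [|th thE] := ker_factor (phi := d \o phi').
  by move=> x /=; rewrite phi'E hphi.
have [|om omE] := hC th.
  by move=> c; have [b <-] := gs c; rewrite thE /= res_dd.
exists (phi' \- (om \o g)) => x /=.
  by rewrite linearB -omE thE subrr.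
by rewrite gf linear0 subr0.
Qed.

Lemma ext_sub i : ext0 i B -> ext0 i.+1 C -> ext0 i A.
Proof.
move=> hB hC phi /(ext_lift hC)[psi /hB[om omE] psiE].
by exists (om \o f) => x; rewrite -psiE omE.
Qed.

(** [phi \o f] represents a preimage of the class of [th] under the connecting map from Ext^i(A, R)
    to Ext^(i+1)(C, R). *)
Lemma ext_connect i (th : {linear C -> E i.+2}) : ext0 i.+1 B -> cocycle th ->
  exists phi : {linear B -> E i.+1},
    (forall x, th (g x) = d (phi x)) /\ cocycle (phi \o f).
Proof.
move=> hB hth; have [|phi phiE] := hB (th \o g); first by move=> x /=.
exists phi; split=> [|x] //=; by rewrite -phiE /= gf linear0.
Qed.

Lemma ext_quot i : ext0 i A -> ext0 i.+1 B -> ext0 i.+1 C.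
Proof.
case: fg_ses => fi gs _ hA hB th /(ext_connect hB)[phi [phiE /hA[om omE]]].
have [om' om'E] := res_inj om fi.
have [|ch chE] := ker_factor (phi := phi \- (d \o om')).
  by move=> x /=; rewrite om'E -omE subrr.
exists ch => c; have [b <-] := gs c.
by rewrite chE phiE /= linearB /= res_dd subr0.
Qed.

Lemma ext_quot0 : ext0 0 B -> ext0 0 C.
Proof.
case: fg_ses => _ gs _ hB phi hphi; have [|psi psiE] := hB (phi \o g).
  by move=> x /=.
exists \0 => c; have [b <-] := gs c.
by move: (psiE b) => /= ->; rewrite (res_0 (psi b)).
Qed.

Lemma ext_mid i : ext0 i A -> ext0 i C -> ext0 i B.
Proof.
case: fg_ses => fi gs _ hA hC phi hphi; have [|om omE] := hA (phi \o f).
  by move=> x /=.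
have [om' om'E] := res_inj om fi.
have [|th thE] := ker_factor (phi := phi \- (d \o om')).
  by move=> x /=; rewrite om'E -omE subrr.
have [|ch chE] := hC th.
  by move=> c; have [b <-] := gs c; rewrite thE /= linearB hphi /= res_dd subr0.
exists (om' \+ (ch \o g)) => x /=.
by rewrite linearD -chE thE /= addrC subrK.
Qed.

(** A degree 0 cocycle is a map to R followed by [res_eta], so this is [ext_lift] in degree 0. *)
Lemma ext1_extend (h : {linear A -> R^o}) : ext0 1 C ->
  exists h' : {linear B -> R^o}, forall x, h' (f x) = h x.
Proof.
move=> hC; have [|psi hpsi psiE] := @ext_lift 0 (@res_eta R E \o h) hC.
  by move=> x; apply/res_exact0; exists (h x).
have [h' h'E] : exists h' : {linear B -> R^o}, forall x, res_eta E (h' x) = psi x.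
  by apply: (factor_inj (@res_eta_inj R E)) => x; apply/res_exact0.
by exists h' => x; apply: (@res_eta_inj R E); rewrite h'E psiE.
Qed.

End LongExactSequence.

Definition vanish N c := forall i, (c <= i)%N -> ext0 i N.

Lemma vanish_free n : vanish 'rV[R]_n 1.
Proof. by case=> // i _; apply: ext_free. Qed.

Lemma vanish_retract c M N (h : {linear M -> N}) (h' : {linear N -> M}) :
  (forall x, h' (h x) = x) -> vanish N c -> vanish M c.
Proof. by move=> hK hN i ci; apply: (ext_retract hK); apply: hN. Qed.

Lemma vanish_mid A B C (f : {linear A -> B}) (g : {linear B -> C}) c : ses f g ->
  vanish A c -> vanish C c -> vanish B c.
Proof. by move=> h hA hC i ci; apply: (ext_mid h); [apply: hA|apply: hC]. Qed.

Lemma ext_not_R : ~ ext0 0 (R^o).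
Proof.
move=> h; have [|psi psiE] := h (res_eta E).
  by move=> x; apply/res_exact0; exists x.
have e : res_eta E (1 : R) = res_eta E 0 by rewrite psiE (res_0 (psi 1)) !linear0.
by have /eqP := oner_neq0 R; apply; exact: (@res_eta_inj R E _ _ e).
Qed.

(** Ext^i(N, R) is generated by the classes of the cocycles [v j]. *)
Definition extfg i N := exists g (v : 'I_g -> {linear N -> E i.+1}),
  (forall j, cocycle (v j)) /\
  forall phi : {linear N -> E i.+1}, cocycle phi ->
    exists (c : 'I_g -> R) (psi : {linear N -> E i}),
      forall x, phi x = \sum_j c j *: v j x + d (psi x).

Lemma presentation N : fg N -> exists n (K : lmodType R) (f : {linear K -> 'rV[R]_n})
    (p : {linear 'rV[R]_n -> N}), ses f p.
Proof.
move=> [n [p ps]]; have [K [f [fi fE]]] := sub_exists (ker_submod p).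
by exists n, K, f, p.
Qed.

Section Noetherian.
Hypothesis noethR : noetherian R.

(** In degree 0, Hom(N, R) embeds into R^n through the values on generators. In degree i + 1, the
    connecting map from Ext^i(K, R), with K the kernel of a presentation, is onto. *)
Lemma ext_fg i N : fg N -> extfg i N.
Proof.
elim: i N => [|i IH] N fgN; have [n [K [f [p hs]]]] := presentation fgN;
  have [fi ps ex] := hs.
  have [s hsp] : fin_gen 'rV[R]_n by apply/fin_gen_fg/fg_row.
  pose H (h : 'rV[R]_n) := exists chi : {linear N -> R^o},
    forall k, chi (p (delta_mx 0 k)) = h 0 k.
  have hH : is_submod H.
    split; first by exists \0 => k; rewrite mxE.
    move=> a u v [c1 e1] [c2 e2]; exists (a \*: c1 \+ c2) => k /=.
    by rewrite e1 e2 !mxE.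
  have [t tH ht] := sub_fin noethR s hH.
  have /boolp.choice[chi chiE] (j : 'I_(size t)) : exists chi : {linear N -> R^o},
      forall k, chi (p (delta_mx 0 k)) = t`_j 0 k.
    by apply: tH; apply: mem_nth.
  exists (size t), (fun j => res_eta E \o chi j); split.
    by move=> j x; apply/res_exact0; exists (chi j x).
  move=> phi hphi.
  have [h hE] : exists h : {linear N -> R^o}, forall x, res_eta E (h x) = phi x.
    by apply: (factor_inj (@res_eta_inj R E)) => x; apply/res_exact0.
  have /spanP[c cE] : \row_k h (p (delta_mx 0 k)) \in span t.
    by apply: ht; [exists h => k; rewrite mxE|apply: hsp].
  exists (c 0), \0 => x; rewrite linear0 addr0 -hE.
  under eq_bigr do rewrite /= -linearZ; rewrite -linear_sum; congr (res_eta E _).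
  have [z <-] := ps x; rewrite row_hom_compE.
  under [RHS]eq_bigr do rewrite row_hom_compE scaler_sumr.
  rewrite exchange_big; apply: eq_bigr => k _ /=.
  have -> : h (p (delta_mx 0 k)) = \sum_i c 0 i *: (t`_i 0 k : R^o).
    have := congr1 (fun r : 'rV_n => r 0 k) cE; rewrite mxE summxE => ->.
    by apply: eq_bigr => j _; rewrite mxE.
  rewrite scaler_sumr; apply: eq_bigr => j _.
  by rewrite chiE scalerA [z 0 k * _]mulrC -scalerA.
have [g [v [vc hv]]] := IH K (fg_sub noethR fi (fg_row R n)).
have /boolp.choice[v' v'E] (j : 'I_g) : exists h : {linear 'rV_n -> E i.+1},
    forall x, h (f x) = v j x by exact: res_inj.
have pf x : p (f x) = 0 by apply/ex; exists x.
have /boolp.choice[th thE] (j : 'I_g) : exists h : {linear N -> E i.+2},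
    forall x, h (p x) = d (v' j x).
  have [|h hE] := factor_surj (f := d \o v' j) ps; last by exists h.
  by move=> x /ex[a <-] /=; rewrite v'E vc.
exists g, th; split.
  by move=> j x; have [z <-] := ps x; rewrite thE res_dd.
move=> phi hphi.
have [ph [phE /hv[c [psi psiE]]]] := ext_connect hs (ext_free (i := i) (n := n)) hphi.
have [psi' psi'E] := res_inj psi fi.
have [sv svE] : exists sv : {linear 'rV_n -> E i.+1},
    forall x, sv x = \sum_j c j *: v' j x.
  apply: linP => a x y; rewrite scaler_sumr -big_split; apply: eq_bigr => j _ /=.
  by rewrite linearP scalerDr !scalerA [c j * a]mulrC.
have [|om omE] := factor_surj (f := ph \- sv \- (d \o psi')) ps.
  move=> x /ex[a <-] /=; rewrite psi'E -[ph _]/((ph \o f) a) psiE svE.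
  under [in X in _ - X - _]eq_bigr do rewrite v'E.
  by apply/eqP; rewrite subr_eq0 subr_eq addrC.
exists c, om => x; have [z <-] := ps x.
rewrite omE phE /= !linearB /= res_dd subr0 svE linear_sum addrC.
rewrite -[LHS](subrK (\sum_j d (c j *: v' j z))).
by congr (_ + _); apply: eq_bigr => j _; rewrite linearZ thE.
Qed.

End Noetherian.
End Ext.

(** * Injective dimension *)

Section InjectiveDimension.
Variables (R : comNzRingType) (m : idealr R) (E : injres R).
Hypotheses (noethR : noetherian R) (locR : local_ring m).
Implicit Types (A B C M N : lmodType R) (x : seq R).

(** Multiplication by [a] is onto on Ext^i(N, R), because the next term Ext^(i+1)(C, R) is zero;
    Ext^i(N, R) is finitely generated and [a] lies in m. *)
Lemma ext_nakayama i N C (f : {linear N -> N}) (g : {linear N -> C}) a : fg N ->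
  a \in m -> (forall y, f y = a *: y) -> ses f g -> ext0 E i.+1 C -> ext0 E i N.
Proof.
move=> fgN am fE hs hC; have [k [v [vc hv]]] := ext_fg E noethR i fgN.
pose P (u : N -> E i.+1) := exists psi : {linear N -> E i},
  forall y, u y = res_d E i (psi y).
have hP : is_submod P.
  split; first by exists \0 => y; rewrite linear0.
  move=> b u w [p1 e1] [p2 e2]; exists (b \*: p1 \+ p2) => y /=.
  by rewrite linearP -e1 -e2.
have vP j : P (v j).
  apply: (nakayama_family noethR locR (v := fun j => v j : N -> E i.+1) hP) => {}j.
  have [psi /hv[c [om omE]] psiE] := ext_lift hs hC (vc j).
  exists (\row_l (a * c l)); split=> [l|]; first by rewrite mxE mulrC idealMr.
  exists (a \*: om) => y /=; rewrite -[LHS]/(v j y - (\sum_l _ *: _) y) fct_sumE.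
  have {1}-> : v j y = a *: psi y by rewrite -psiE fE linearZ_LR.
  rewrite omE scalerDr scaler_sumr linearZ_LR addrAC.
  rewrite [X in X - _](_ : _ =
      \sum_l ((\row_l (a * c l)) 0 l *: (v l : N -> E i.+1)) y).
    by rewrite subrr add0r.
  by apply: eq_bigr => l _; rewrite -[RHS]/(_ *: v _ y) mxE scalerA.
move=> phi /hv[c [om omE]].
have /boolp.choice[w wE] j := vP j.
have [s sE] : exists s : {linear N -> E i}, forall y, s y = \sum_j c j *: w j y.
  apply: linP => b y z; rewrite scaler_sumr -big_split; apply: eq_bigr => j _ /=.
  by rewrite linearP scalerDr !scalerA [c j * b]mulrC.
exists (s \+ om) => y; rewrite omE /= linearD sE linear_sum; congr (_ + _).
by apply: eq_bigr => j _; rewrite linearZ_LR -wE.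
Qed.

(* The exact sequence 0 -> N_i -> N_i -> N_(i+1) -> 0, where
   N_i = N / (x_0, .., x_(i-1)) N and the first map is multiplication by x_i. *)
Lemma regular_ses N x n i C (g : {linear N -> C}) : wreg N x n -> (i < n)%N ->
  (forall c, exists y, g y = c) -> (forall y, g y = 0 <-> qmul x i y) ->
  exists (f : {linear C -> C}) C' (g' : {linear N -> C'}) (h : {linear C -> C'}),
    [/\ forall y, f y = x`_i *: y, ses f h,
        forall c, exists y, g' y = c & forall y, g' y = 0 <-> qmul x i.+1 y].
Proof.
move=> hr lt gs gE.
have [f fE] : exists f : {linear C -> C}, forall y, f y = x`_i *: y.
  by apply: linP => a u v; rewrite scalerDr !scalerA mulrC.
have [C' [g' [g's g'E]]] := quot_exists (qmul_submod N x i.+1).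
have [h hE] : exists h : {linear C -> C'}, forall y, h (g y) = g' y.
  by apply: factor_surj gs _ => y /gE/qmulS/g'E.
exists f, C', g', h; split=> //; split.
- move=> u v; rewrite !fE => e; have [y yE] := gs (u - v).
  apply/eqP; rewrite -subr_eq0 -yE; apply/eqP/gE; apply: (hr i lt).
  by apply/gE; rewrite linearZ_LR yE scalerBr e subrr.
- by move=> c; have [y <-] := g's c; exists (g y).
move=> c; have [y <-] := gs c; rewrite hE g'E; split=> [[u /gE]|[u]].
  rewrite linearB linearZ_LR => /eqP; rewrite subr_eq0 => /eqP->.
  by exists (g u); rewrite fE.
have [w <-] := gs u; rewrite fE -linearZ_LR => e; exists w; apply/gE.
by rewrite linearB e subrr.
Qed.

(** The quotient of N is any [C] with the right kernel, so a rewriting of the index [i] affects only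
    the kernel condition and no module type. *)
Definition qvanish N x i c := forall C (g : {linear N -> C}),
  (forall u, exists y, g y = u) -> (forall y, g y = 0 <-> qmul x i y) -> vanish E C c.

(** Dropping one element of the sequence lowers the vanishing bound by one, by [ext_nakayama]. *)
Lemma qvanish_down N x n c k : fg N -> wreg N x n ->
  (forall i, (i < n)%N -> x`_i \in m) -> (k <= n)%N -> qvanish N x n c ->
  qvanish N x (n - k) (c - k).
Proof.
move=> fgN hr xm; elim: k => [|k IH] le h; first by rewrite !subn0.
have lt : (n - k.+1 < n)%N by rewrite ltn_subrL; case: (n) le.
move=> C g gs gE; have [f [C' [g' [hh [fE hs g's g'E]]]]] := regular_ses hr lt gs gE.
have nE : (n - k.+1).+1 = (n - k)%N by rewrite -subSn.
rewrite nE in g'E; have v' := IH (ltnW le) h C' g' g's g'E.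
move=> i ci; apply: (ext_nakayama (fg_surj gs fgN) (xm _ lt) fE hs); apply: v'.
by move: ci; rewrite !leq_subLR addSnnS.
Qed.

(** With bound 0, Hom included, vanishing passes to each further quotient by the long exact
    sequence. *)
Lemma qvanish_up N x n k : wreg N x n -> (k <= n)%N -> qvanish N x k 0 ->
  qvanish N x n 0.
Proof.
move=> hr le h; rewrite -(subnKC le).
suff: forall j, (j <= n - k)%N -> qvanish N x (k + j) 0 by apply.
elim=> [|j IH] lej; first by rewrite addn0.
have {}IH := IH (ltnW lej); have lt : (k + j < n)%N by rewrite -ltn_subRL.
have [C [g [gs gE]]] := quot_exists (qmul_submod N x (k + j)).
have [f [C' [g' [hh [fE hs g's g'E]]]]] := regular_ses hr lt gs gE.
have vC := IH C g gs gE; move=> D gD gDs gDE.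
have [h1 h1E] : exists h1 : {linear D -> C'}, forall y, h1 (gD y) = g' y.
  by apply: (factor_surj gDs) => y /gDE; rewrite addnS => /g'E.
have [h2 h2E] : exists h2 : {linear C' -> D}, forall y, h2 (g' y) = gD y.
  by apply: (factor_surj g's) => y /g'E; rewrite -addnS => /gDE.
apply: (vanish_retract (h := h1) (h' := h2)).
  by move=> y; have [z <-] := gDs y; rewrite h1E h2E.
case=> [|i] _; first by apply: (ext_quot0 hs); apply: vC.
by apply: (ext_quot hs); apply: vC.
Qed.

Definition cyclic_mod N (z : N) (J : R -> Prop) :=
  (forall y, exists a, y = a *: z) /\ forall a, a *: z = 0 <-> J a.

Lemma cyclic_sub N (z : N) : exists A (f : {linear A -> N}) (w : A),
  [/\ injective f, f w = z & forall y, exists a, y = a *: w].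
Proof.
have hP : is_submod (fun y : N => exists a, a *: z = y).
  split; first by exists 0; rewrite scale0r.
  move=> a _ _ [b <-] [e <-]; exists (a * b + e).
  by rewrite scalerDl scalerA.
have [A [f [fi fE]]] := sub_exists hP.
have [|w wE] := (fE z).1; first by exists 1; rewrite scale1r.
exists A, f, w; split=> // y; have [|a aE] := (fE (f y)).2; first by exists y.
by exists a; apply: fi; rewrite linearZ_LR wE.
Qed.

Lemma cyclic_fg N (z : N) J : cyclic_mod z J -> fg N.
Proof.
move=> [gen _]; apply/fin_gen_fg; exists [:: z] => y; have [a ->] := gen y.
apply: (submodZ (span_submod [:: z])); apply: mem_span; exact: mem_head.
Qed.

(* Bass: a cyclic module N = R / J with J <> m is an extension of two cyclic
   modules with larger annihilators, or some a in m is regular on N and Nakayama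
   applies to Ext^i(N / a N, R). *)
Lemma bass_cyclic c :
  (forall N (z : N), cyclic_mod z (fun a => a \in m) -> vanish E N c) ->
  forall J, is_ideal J -> forall N (z : N), cyclic_mod z J -> vanish E N c.
Proof.
move=> hk; apply: (noeth_ind noethR) => J hJ IH N z [gen ann].
have big K M (w : M) b : K b -> ~ J b -> (forall a, J a -> K a) ->
    cyclic_mod w K -> vanish E M c.
  move=> Kb nJb sub [wgen wann].
  apply: (IH (fun a => a *: w = 0) _ _ _ M w) => //.
  - exact: ann_ideal.
  - by move=> a /sub/wann.
  - by exists b; split=> //; apply/wann.
have [J1|J1] := pselect (J 1).
  move=> i _; apply: ext_trivial => y; have [a ->] := gen y.
  by rewrite -[z]scale1r (ann 1).2 // scaler0.
have [mJ|] := pselect (forall a, a \in m -> J a).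
  apply: (hk N z); split=> // a; split=> [/ann|/mJ h]; last exact/ann.
  exact: (ideal_sub_m noethR locR hJ J1).
move=> /existsNP[a /not_implyP[am nJa]].
have [reg|] := pselect (forall b, J (a * b) -> J b).
  have [f fE] : exists f : {linear N -> N}, forall y, f y = a *: y.
    by apply: linP => b u v; rewrite scalerDr !scalerA mulrC.
  have [C [g [gs gE]]] := quot_exists (image_submod f).
  have hs : ses f g.
    split=> // u v; rewrite !fE => e; apply/eqP; rewrite -subr_eq0; apply/eqP.
    have [b bE] := gen (u - v); rewrite bE; apply/ann; apply: reg; apply/ann.
    by rewrite -scalerA -bE scalerBr e subrr.
  have vC : vanish E C c.
    apply: (big (fun b => b *: g z = 0) C (g z) a) => //.
    - by rewrite -linearZ_LR; apply/gE; exists z; rewrite fE.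
    - by move=> b /ann h; rewrite -linearZ_LR h linear0.
    - split=> // y; have [w <-] := gs y; have [b ->] := gen w.
      by exists b; rewrite linearZ_LR.
  move=> i ci; apply: (ext_nakayama _ am fE hs); last by apply: vC; apply: leqW.
  exact: (cyclic_fg (J := J) (conj gen ann)).
move=> /existsNP[b /not_implyP[Jab nJb]].
have [A [f [w [fi fw wgen]]]] := cyclic_sub (b *: z).
have [C [g [gs gE]]] := quot_exists (image_submod f).
have hs : ses f g by split.
apply: (vanish_mid hs).
  apply: (big (fun e => e *: w = 0) A w a) => //.
    by apply: fi; rewrite linearZ_LR fw linear0 scalerA; apply/ann.
  move=> e /ann h; apply: fi; rewrite linearZ_LR fw linear0.
  by rewrite scalerA mulrC -scalerA h scaler0.
apply: (big (fun e => e *: g z = 0) C (g z) b) => //.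
- by rewrite -linearZ_LR; apply/gE; exists w.
- by move=> e /ann h; rewrite -linearZ_LR h linear0.
- split=> // y; have [v <-] := gs y; have [e ->] := gen v.
  by exists e; rewrite linearZ_LR.
Qed.

Lemma bass c :
  (forall N (z : N), cyclic_mod z (fun a => a \in m) -> vanish E N c) ->
  forall N, fg N -> vanish E N c.
Proof.
move=> hk N /fin_gen_fg[s]; move sn: (size s) => n.
elim: n N s sn => [|n IH] N s.
  move=> /size0nil-> hs i _; apply: ext_trivial => y.
  by have /spanP[e ->] := hs y; rewrite big_ord0.
case: s => // a s [sn] hs; have [A [f [w [fi fw wgen]]]] := cyclic_sub a.
have [C [g [gs gE]]] := quot_exists (image_submod f).
apply: (vanish_mid (f := f) (g := g)); first by split.
  apply: (bass_cyclic hk (J := fun e => e *: w = 0) _ (z := w)) => //.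
  exact: ann_ideal.
apply: (IH C (map g s)); first by rewrite size_map.
move=> y; have [u <-] := gs y; have /mem_span_cons[e /spanP[b bE]] := hs u.
have ga : g (e *: a) = 0 by apply/gE; exists (e *: w); rewrite linearZ_LR fw.
rewrite -[g u]subr0 -ga -linearB bE linear_sum; have hS := span_submod (map g s).
apply: (submod_sum hS) => i _; rewrite linearZ_LR; apply: (submodZ hS).
by apply: mem_span; apply: map_f; apply: mem_nth.
Qed.

(* [e] is the injective dimension of R. *)
Lemma injdim_exists n : (forall i, (n < i)%N -> forall y : E i, y = 0) ->
  exists2 e, forall N, fg N -> vanish E N e.+1 &
    forall N (z : N), fg N -> (forall a, a *: z = 0 <-> a \in m) -> ~ ext0 E e N.
Proof.
move=> En; pose S c := `[<forall N, fg N -> vanish E N c>].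
have exS : exists c, S c.
  exists n; apply/asboolP => N _ i ni phi _; exists \0 => y.
  by rewrite linear0; apply: En.
(* The least bound is not 0 because Hom(R, R) is nonzero; so it is a successor. *)
case: (ex_minnP exS) => -[/asboolP h|e /asboolP he emin].
  by case: (ext_not_R (h _ (fg_ring R) 0%N isT)).
exists e => // N z fgN zann h.
(* By [bass], [e] would already be a bound if Ext^e vanished on the residue field. That field is the
   submodule A = R z of N, and Ext^e(N, R) maps onto Ext^e(A, R) since Ext^(e+1) vanishes. *)
suff : S e by move=> /emin; rewrite ltnn.
apply/asboolP; apply: bass => K u [ugen uann] i.
rewrite leq_eqVlt => /orP[/eqP<-|lt]; last first.
  by apply: (he _ _) lt; apply: cyclic_fg (conj ugen uann).
have [A [f [w [fi fw wgen]]]] := cyclic_sub z.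
have [C [g [gs gE]]] := quot_exists (image_submod f).
have hs : ses f g by split.
have hA : ext0 E e A by apply: (ext_sub hs h); apply: (he _ (fg_surj gs fgN)).
have lin (L : lmodType R) (v : L) :
    exists p : {linear R^o -> L}, forall a, p a = a *: v.
  by apply: linP => a b b'; rewrite scalerDl scalerA.
have [pw pwE] := lin A w; have [pu puE] := lin K u.
have wann a : a *: w = 0 <-> a \in m.
  rewrite -zann -fw -linearZ_LR; split=> [->|e0]; first exact: linear0.
  by apply: fi; rewrite e0 linear0.
have [q qE] : exists q : {linear K -> A}, forall a, q (pu a) = pw a.
  apply: factor_surj => [y|a]; first by have [a ->] := ugen y; exists a; rewrite puE.
  by rewrite puE pwE => /uann/wann.
have [q' q'E] : exists q : {linear A -> K}, forall a, q (pw a) = pu a.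
  apply: factor_surj => [y|a]; first by have [a ->] := wgen y; exists a; rewrite pwE.
  by rewrite puE pwE => /wann/uann.
apply: (ext_retract (h := q) (h' := q')) hA => y.
by have [a ->] := ugen y; rewrite -puE qE q'E.
Qed.

End InjectiveDimension.

(** * The Koszul complex *)

Local Notation mxs :=
  (mul0mx, mulmx0, mul1mx, mulmx1, mulNmx, mulmxN, opprK, add0r, addr0).

Section Koszul.
Variable R : comNzRingType.
Implicit Types (s x : seq R).

Fixpoint kos_rank s (i : nat) : nat :=
  if s is _ :: s' then
    if i is j.+1 then (kos_rank s' j.+1 + kos_rank s' j)%N else kos_rank s' 0
  else (i == 0%N).

(* The Koszul complex of a :: s is the mapping cone of the multiplication by a
   on the Koszul complex of s. *)
Fixpoint kos_d s : forall i, 'M[R]_(kos_rank s i.+1, kos_rank s i) :=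
  match s with
  | [::] => fun i => 0
  | a :: s' => fun i =>
    match i return 'M[R]_(kos_rank (a :: s') i.+1, kos_rank (a :: s') i) with
    | 0 => col_mx (kos_d s' 0) a%:M
    | j.+1 => block_mx (kos_d s' j.+1) 0 a%:M (- kos_d s' j)
    end
  end.

Lemma kos_dd s i : kos_d s i.+1 *m kos_d s i = 0.
Proof.
elim: s i => [|a s IH] i /=; first by rewrite mul0mx.
case: i => [|i] /=.
  rewrite mul_block_col IH mul0mx addr0 mulNmx mul_scalar_mx mul_mx_scalar subrr.
  by rewrite col_mx0.
rewrite mulmx_block !IH !mul0mx !mulmx0 !mulmxN !mulNmx !opprK IH !addr0.
by rewrite mul_scalar_mx mul_mx_scalar subrr; apply: block_mx_const.
Qed.

Lemma kos_rank0 s : kos_rank s 0 = 1%N.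
Proof. by elim: s. Qed.

Lemma kos_rank_big s i : (size s < i)%N -> kos_rank s i = 0%N.
Proof.
by elim: s i => [|a s IH] [|i] //= lt; rewrite !IH // ltnW.
Qed.

(** Each element of [s] acts null-homotopically. For the head of the list the homotopy is the
    identity between the two summands of the cone; for the others it is that of the tail, with a
    sign on the shifted summand. *)
Lemma kos_homotopy s a : a \in s ->
  exists h : forall i, 'M[R]_(kos_rank s i, kos_rank s i.+1),
    h 0%N *m kos_d s 0 = a%:M /\
    forall i, h i.+1 *m kos_d s i.+1 + kos_d s i *m h i = a%:M.
Proof.
elim: s => // b s IH; rewrite inE => /predU1P[->|/IH[h [h0 hS]]].
  exists (fun i => match i return 'M_(kos_rank (b :: s) i, kos_rank (b :: s) i.+1) with
    | 0 => row_mx 0 1%:M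
    | j.+1 => block_mx 0 1%:M 0 0
    end); split=> /= [|[|i] /=].
  - by rewrite mul_row_col !mxs.
  - rewrite mulmx_block mul_col_row !mxs add_block_mx !mxs addNr.
    by rewrite -scalar_mx_block.
  rewrite !mulmx_block !mxs add_block_mx !mxs addNr.
  by rewrite -scalar_mx_block.
exists (fun i => match i return 'M_(kos_rank (b :: s) i, kos_rank (b :: s) i.+1) with
    | 0 => row_mx (h 0%N) 0
    | j.+1 => block_mx (h j.+1) 0 0 (- h j)
    end); split=> /= [|[|i] /=].
- by rewrite mul_row_col !mxs h0.
- rewrite mulmx_block mul_col_row !mxs add_block_mx mul_scalar_mx mul_mx_scalar.
  by rewrite !mxs addNr hS h0 -scalar_mx_block.
rewrite !mulmx_block !mxs add_block_mx mul_scalar_mx mul_mx_scalar.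
by rewrite !mxs addNr !hS -scalar_mx_block.
Qed.

Definition kos_exact s := forall i (z : 'rV[R]_(kos_rank s i.+1)),
  z *m kos_d s i = 0 -> exists u, z = u *m kos_d s i.+1.

Lemma kos_torsion s i (z : 'rV[R]_(kos_rank s i.+1)) a : z *m kos_d s i = 0 ->
  a \in pideal s -> exists u, a *: z = u *m kos_d s i.+1.
Proof.
move=> hz; pose P (w : 'rV[R]_(kos_rank s i.+1)) := exists u, w = u *m kos_d s i.+1.
have hP : is_submod P.
  split; first by exists 0; rewrite mul0mx.
  move=> b v w [v' ->] [w' ->]; exists (b *: v' + w').
  by rewrite mulmxDl scalemxAl.
move: a; apply: (span_sub (M := R^o) (submod_ideal z hP)) => a /kos_homotopy[h [_ hS]].
exists (z *m h i.+1); rewrite -mul_mx_scalar -(hS i) mulmxDr !mulmxA hz.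
by rewrite mul0mx addr0.
Qed.

Lemma kos_d0_ideal s (J : R -> Prop) : is_ideal J -> (forall a, a \in s -> J a) ->
  forall i j, J (kos_d s 0 i j).
Proof.
move=> hJ; elim: s => [|a s IH] hs i j /=; first by rewrite mxE; exact: (submod0 hJ).
rewrite mxE; case: splitP => k _.
  by apply: IH => b bs; apply: hs; rewrite inE bs orbT.
rewrite mxE; case: eqP => _; last by rewrite mulr0n; exact: (submod0 hJ).
by rewrite mulr1n; apply: hs; rewrite mem_head.
Qed.

(** The degree 0 term is R, but its rank is 1 only up to a proof, so [const_mx c] stands for c. The
    list is reversed because the cone adds elements in front, whereas a regular sequence grows at
    its end. *)
Lemma kos_d0_image s c :
  (exists p, p *m kos_d s 0 = const_mx c :> 'rV_(_)) <->
  qmul (M := R^o) (rev s) (size s) c.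
Proof.
have hQ := qmul_submod R^o (rev s) (size s).
split=> [[p pE]|].
  have lt : (0 < kos_rank s 0)%N by rewrite kos_rank0.
  have -> : c = (p *m kos_d s 0) 0 (Ordinal lt) by rewrite pE mxE.
  rewrite mxE; apply: (submod_sum hQ) => i _; apply: (is_idealMl _ hQ).
  apply: kos_d0_ideal => // a; rewrite -mem_rev => /(nthP 0)[k].
  rewrite size_rev => lk <-.
  by rewrite -[_`_k]mulr1; apply: (mem_qmul (M := R^o)).
have hP : is_ideal (fun c => exists p, p *m kos_d s 0 = const_mx c :> 'rV_(_)).
  split; first by exists 0; rewrite mul0mx; apply/matrixP => i j; rewrite !mxE.
  move=> a u v [p pE] [q qE]; exists (a *: p + q); rewrite mulmxDl -scalemxAl pE qE.
  by apply/matrixP => i j; rewrite !mxE.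
apply: (qmul_min hP) => i u lt.
have /kos_homotopy[h [h0 _]] : (rev s)`_i \in s by rewrite -mem_rev mem_nth ?size_rev.
exists (const_mx u *m h 0%N); rewrite -mulmxA h0 mul_mx_scalar.
by apply/matrixP => j k; rewrite !mxE.
Qed.

Lemma eq_qmul (M : lmodType R) x x' j (y : M) :
  (forall i, (i < j)%N -> x`_i = x'`_i) -> qmul x j y -> qmul x' j y.
Proof.
elim: j y => [|j IH] y e //= [u hu]; exists u; rewrite -e //.
by apply: IH hu => i lt; apply: e; apply: leqW.
Qed.

Section LocalKoszul.
Variable m : idealr R.
Hypotheses (noethR : noetherian R) (locR : local_ring m).

(** By the exact sequence of the cone, [a] acts surjectively on the positive homology of [s], and
    Nakayama applies to the finitely generated module [Z] of cycles. *)
Lemma kos_exact_cons a s : a \in m -> kos_exact (a :: s) -> kos_exact s.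
Proof.
move=> am ex i.
have hZ : is_submod (fun z : 'rV[R]_(kos_rank s i.+1) => z *m kos_d s i = 0).
  split; first by rewrite mul0mx.
  by move=> b u v hu hv; rewrite mulmxDl -scalemxAl hu hv scaler0 addr0.
have [Z [f [fi fE]]] := sub_exists hZ; move=> z /fE[w <-]; move: w.
have hP : is_submod (fun w : Z => exists u, f w = u *m kos_d s i.+1).
  split; first by exists 0; rewrite linear0 mul0mx.
  move=> b v w [v' ve] [w' we]; exists (b *: v' + w').
  by rewrite linearP ve we mulmxDl scalemxAl.
apply: (nakayama1 noethR locR (fg_sub noethR fi (fg_row _ _)) am hP) => w.
have wz : f w *m kos_d s i = 0 by apply/fE; exists w.
have [|u] := ex i (row_mx (f w) 0).
  case: (i) (f w) wz => [|j] v hv; first by rewrite /= mul_row_col hv !mxs.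
  by rewrite /= mul_row_block hv !mxs row_mx0.
rewrite -[u]hsubmxK /= mul_row_block => /eq_row_mx[e1 e2].
have /fE[v vE] : rsubmx u *m kos_d s i = 0.
  by move/esym/eqP: e2; rewrite mulmx0 add0r mulmxN oppr_eq0 => /eqP.
exists v, (lsubmx u); rewrite linearB linearZ /= e1 vE.
by rewrite mul_mx_scalar addrK.
Qed.

(** Exactness in degree 1 for [a :: s] says that [a], the last element after reversal, is regular
    modulo the ideal of [s]. *)
Lemma kos_exact_wreg s : {subset s <= m} -> kos_exact s -> wreg R^o (rev s) (size s).
Proof.
elim: s => [//|a s IH] sm ex i.
have am : a \in m by apply: sm; rewrite mem_head.
have {}sm : {subset s <= m} by move=> b bs; apply: sm; rewrite inE bs orbT.
have /IH{IH}hr := kos_exact_cons am ex.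
have nthE k : (k < size s)%N -> (rev (a :: s))`_k = (rev s)`_k.
  by move=> lt; rewrite rev_cons nth_rcons size_rev lt.
have qE k (y : R^o) : (k <= size s)%N -> qmul (rev (a :: s)) k y <-> qmul (rev s) k y.
  move=> le; split; apply: eq_qmul => l lk; rewrite nthE //; exact: leq_trans le.
rewrite ltnS leq_eqVlt => /predU1P[->|lt] y; last first.
  by rewrite !qE ?(ltnW lt) // nthE //; apply: hr.
rewrite !qE // rev_cons nth_rcons size_rev ltnn eqxx => /kos_d0_image[p pE].
(* A relation a y = p d_0 is the 1-cycle (-p, y) of the cone; the second component of a chain
   bounding it shows y in the ideal of [s]. *)
apply/kos_d0_image; have [|u] := ex 0%N (row_mx (- p) (const_mx y)).
  rewrite /= mul_row_col mulNmx pE mul_mx_scalar; apply/matrixP => j k.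
  by rewrite !mxE addNr.
rewrite -[u]hsubmxK /= mul_row_block => /eq_row_mx[_].
by rewrite mulmx0 add0r mulmxN => e; exists (- rsubmx u); rewrite mulNmx -e.
Qed.

End LocalKoszul.
End Koszul.

(** * Injective dimension, depth and systems of parameters *)

Section Gorenstein.
Variables (R : comNzRingType) (m : idealr R) (E : injres R) (e : nat).
Hypotheses (noethR : noetherian R) (locR : local_ring m).
Hypothesis finite_vanish : forall N : lmodType R, fg N -> vanish E N e.+1.
Hypothesis socle_nonvanish : forall (N : lmodType R) (z : N), fg N ->
  (forall a, a *: z = 0 <-> a \in m) -> ~ ext0 E e N.
Implicit Types (A B C M N : lmodType R) (x : seq R).

(** If e < n, dropping e + 1 elements lowers the bound e + 1 to 0. Total vanishing then climbs back
    to M / (x_0, .., x_(n-1)) M, which contains the residue field: a contradiction in degree e. *)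
Lemma injdim_ge_depth M x n (z : M) : fg M -> wreg M x n ->
  (forall i, (i < n)%N -> x`_i \in m) -> (forall a, qmul x n (a *: z) <-> a \in m) ->
  (n <= e)%N.
Proof.
move=> fgM hr xm zann; rewrite leqNgt; apply/negP => lt.
have h : qvanish E M x n e.+1.
  by move=> C g gs _; apply: finite_vanish; apply: fg_surj gs fgM.
have := qvanish_down noethR locR fgM hr xm lt h; rewrite subnn.
move/(qvanish_up hr (leq_subr _ _)) => {}h.
have [C [g [gs gE]]] := quot_exists (qmul_submod M x n).
apply: (socle_nonvanish (z := g z) (fg_surj gs fgM)); last exact: (h C g gs gE).
by move=> a; rewrite -linearZ_LR gE.
Qed.

(** Used with n = e, where the bound is 1: all higher Ext vanish. *)
Lemma wreg_vanish N x n : fg N -> wreg N x n ->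
  (forall i, (i < n)%N -> x`_i \in m) -> vanish E N (e.+1 - n).
Proof.
move=> fgN hr xm; have h : qvanish E N x n e.+1.
  by move=> C g gs _; apply: finite_vanish; apply: fg_surj gs fgN.
have := qvanish_down noethR locR fgN hr xm (leqnn n) h; rewrite subnn => {}h.
by apply: (h N (idfun : {linear N -> N})) => // y; exists y.
Qed.

(* If the complex were not exact at q, for the largest such q, then the
   cokernel at q would contain the residue field and have a free resolution
   shorter than e. *)
Lemma acyclicity l (n : nat -> nat) (D : forall i, 'M[R]_(n i.+1, n i)) (S : {pred R}) :
  (l <= e)%N -> (forall i, (l < i)%N -> n i = 0%N) ->
  (forall i, D i.+1 *m D i = 0) -> m_primary m S ->
  (forall i (z : 'rV_(n i.+1)) a, z *m D i = 0 -> a \in S ->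
     exists u, a *: z = u *m D i.+1) ->
  (forall i (z : 'rV_(n i.+1)), z *m D i = 0 -> exists u, z = u *m D i.+1) /\
  forall C (g : {linear 'rV[R]_(n 0%N) -> C}), (forall y, exists v, g v = y) ->
    (forall v, g v = 0 <-> exists u, v = u *m D 0%N) -> vanish E C l.+1.
Proof.
move=> le n0 DD Sprim tors.
have nz i (z : 'rV[R]_(n i)) : (l < i)%N -> z = 0.
  by move=> /n0 ni; apply/rowP => k; have := ltn_ord k; rewrite {2}ni.
(* Descending induction along the complex. The second half records that the cokernel at l - k has a
   free resolution of length k, from degree l down to l - k. *)
suff /(_ l (leqnn l)) : forall k, (k <= l)%N ->
    (forall i (z : 'rV_(n i.+1)), (l - k <= i)%N -> z *m D i = 0 ->
       exists u, z = u *m D i.+1) /\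
    forall C (g : {linear 'rV[R]_(n (l - k)%N) -> C}), (forall y, exists v, g v = y) ->
      (forall v, g v = 0 <-> exists u, v = u *m D (l - k)%N) -> vanish E C k.+1.
  by rewrite subnn => -[h1 h2]; split=> // i z; apply: h1.
elim=> [|k IH] lek.
  rewrite subn0; split=> [i z li _|C g gs gE].
    by exists 0; rewrite mul0mx; apply: nz.
  have gi v : g v = 0 -> v = 0 by move=> /gE[u ->]; rewrite (nz _ u) ?mul0mx.
  have [h hE] := factor_surj (f := idfun : {linear 'rV_(n l) -> 'rV_(n l)}) gs gi.
  apply: (vanish_retract (h := h) (h' := g)) (@vanish_free R E (n l)) => y.
  by have [v <-] := gs y; rewrite hE.
have [exk vk] := IH (ltnW lek); set q := (l - k.+1)%N.
have qE : (l - k)%N = q.+1 by rewrite /q subnSK.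
move: exk vk; rewrite qE => exk vk.
have imD j : is_submod (fun v : 'rV[R]_(n j) => exists u, v = u *m D j).
  split; first by exists 0; rewrite mul0mx.
  move=> b v w [v' ->] [w' ->]; exists (b *: v' + w').
  by rewrite mulmxDl scalemxAl.
have [C [g [gs gE]]] := quot_exists (imD q.+1).
have vC := vk C g gs gE.
have exq (z : 'rV_(n q.+1)) : z *m D q = 0 -> exists u, z = u *m D q.+1.
  move=> hz; apply: contrapT => nu.
  have hC0 : is_submod (fun y : C => y = 0).
    by split=> // a u v -> ->; rewrite scaler0 addr0.
  have gz : g z <> 0 by move/gE.
  have [a aS|c cE] := torsion_socle noethR locR hC0 gz Sprim _.
    by rewrite -linearZ_LR; apply/gE; apply: tors.
  apply: (socle_nonvanish (z := c *: g z) (fg_surj gs (fg_row _ _)) cE).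
  by apply: vC; apply: leq_trans le.
split=> [i z|C' g' g's g'E].
  rewrite leq_eqVlt => /predU1P[qi|]; last exact: exk.
  by move: z; rewrite -qi => z; apply: exq.
have [r rE] : exists r : {linear 'rV[R]_(n q.+1) -> 'rV[R]_(n q)},
    forall v, r v = v *m D q.
  by apply: linP => a u v; rewrite mulmxDl -scalemxAl.
have [f fE] : exists f : {linear C -> 'rV[R]_(n q)}, forall v, f (g v) = r v.
  by apply: (factor_surj gs) => v /gE[u ->]; rewrite rE -mulmxA DD mulmx0.
have hs : ses f g'.
  split=> // [y y' ff|v].
    have [v vE] := gs (y - y'); apply/eqP; rewrite -subr_eq0 -vE; apply/eqP/gE.
    by apply: exq; rewrite -rE -fE vE linearB ff subrr.
  rewrite g'E; split=> [[u ->]|[y <-]]; first by exists (g u); rewrite fE rE.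
  by have [u <-] := gs y; exists u; rewrite fE rE.
case=> // i ki; apply: (ext_quot hs); first exact: vC.
exact: ext_free.
Qed.

(** The Koszul complex has length at most e and torsion homology, so [acyclicity] applies and x is
    regular. It then resolves R / (x), which contains the residue field; were its length less than
    e, Ext^e of R / (x) would vanish. *)
Lemma sop_regular x : {subset x <= m} -> m_primary m (pideal x) -> (size x <= e)%N ->
  wreg R^o x (size x) /\ e = size x.
Proof.
move=> xm prim le; set s := rev x.
have sx : pideal s =i pideal x.
  move=> a; have sub (t t' : seq R) :
      {subset t <= t'} -> a \in pideal t -> a \in pideal t'.
    move=> st; apply: (span_sub (M := R^o) (pideal_ideal t')) => b /st.
    exact: (mem_span (M := R^o)).
  by apply/idP/idP; apply: sub => b; rewrite mem_rev.
have sm : {subset s <= m} by move=> a; rewrite mem_rev => /xm.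
have ss : size s = size x by rewrite size_rev.
have les : (size s <= e)%N by rewrite ss.
have [ex v0] := acyclicity (l := size s) (n := kos_rank s) (D := kos_d s)
  (S := pideal x) les
  (@kos_rank_big R s) (kos_dd s) prim
  (fun i z a hz ap => kos_torsion hz (etrans (sx a) ap)).
have hr := kos_exact_wreg noethR locR sm ex; rewrite revK ss in hr.
split=> //; apply/eqP; rewrite eqn_leq le andbT leqNgt; apply/negP => lt.
have hI : is_submod (fun v : 'rV[R]_(kos_rank s 0) => exists u, v = u *m kos_d s 0).
  split; first by exists 0; rewrite mul0mx.
  move=> b v w [v' ->] [w' ->]; exists (b *: v' + w').
  by rewrite mulmxDl scalemxAl.
have [C [g [gs gE]]] := quot_exists hI.
have one0 : ~ (g (const_mx 1) = 0).
  move=> /gE[u uE]; have : 1 \in m; last by rewrite idealr1.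
  have : qmul (M := R^o) (rev s) (size s) 1 by apply/kos_d0_image; exists u.
  apply: (qmul_min (idealr_ideal m)) => i b li; rewrite -[_ *: _]/(_ * _) mulrC.
  by apply: idealMr; apply: xm; rewrite /s revK mem_nth -?ss.
have hC0 : is_submod (fun y : C => y = 0).
  by split=> // a u v -> ->; rewrite scaler0 addr0.
have [a aS|c cE] := torsion_socle noethR locR hC0 one0 prim _.
  rewrite -linearZ_LR; apply/gE.
  have /kos_d0_image[u uE] : qmul (M := R^o) (rev s) (size s) a.
    by rewrite /s revK size_rev; apply/qmul_ideal.
  by exists u; rewrite uE; apply/matrixP => i j; rewrite !mxE mulr1.
apply: (socle_nonvanish (z := c *: g (const_mx 1)) (fg_surj gs (fg_row _ _)) cE).
by apply: (v0 C g gs gE); rewrite ss.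
Qed.

End Gorenstein.

(** * Lifting maps to R modulo a regular sequence *)

Section DualBasis.
Import VectorInternalTheory.
Variable R : comNzRingType.
Implicit Types (F : vectType R).

Lemma lfun_exists F (N : vectType R) (f : {linear F -> N}) :
  exists g : 'Hom(F, N), forall v, g v = f v.
Proof. by exists (linfun f) => v; rewrite lfunE. Qed.

Lemma dual_basis F : exists n (b : 'I_n -> F) (c : 'I_n -> 'Hom(F, R^o)),
  (forall v, v = \sum_k c k v *: b k) /\ forall k l, c k (b l) = (k == l)%:R.
Proof.
exists (dim F), (fun k => r2v (delta_mx 0 k)).
have cP k : exists g : 'Hom(F, R^o), forall v, g v = v2r v 0 k.
  have [f fE] : exists f : {linear F -> R^o}, forall v, f v = v2r v 0 k.
    by apply: linP => a u v; rewrite linearP !mxE.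
  by have [g gE] := lfun_exists f; exists g => v; rewrite gE fE.
have [c cE] := boolp.choice cP; exists c; split=> [v|k l].
  apply: (can_inj v2rK); rewrite linear_sum.
  under eq_bigr do rewrite linearZ /= r2vK cE.
  exact: row_sum_delta.
by rewrite cE r2vK mxE eqxx.
Qed.

Lemma dual_basisE F n (b : 'I_n -> F) (c : 'I_n -> 'Hom(F, R^o)) :
  (forall v, v = \sum_k c k v *: b k) ->
  forall phi : 'Hom(F, R^o), phi = \sum_k phi (b k) *: c k.
Proof.
move=> bE phi; apply/lfunP => v; rewrite {1}[v]bE linear_sum sum_lfunE.
apply: eq_bigr => k _; rewrite linearZ scale_lfunE.
exact: mulrC.
Qed.

Lemma vect_retract F : exists n (h : {linear F -> 'rV[R]_n}) (h' : {linear 'rV[R]_n -> F}),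
  forall v, h' (h v) = v.
Proof.
have [n [b [c [bE _]]]] := dual_basis F.
have [h' h'E] := row_hom b.
have [h hE] : exists h : {linear F -> 'rV[R]_n}, forall v, h v = \row_k c k v.
  by apply: linP => a u v; apply/rowP => k; rewrite !mxE linearP.
by exists n, h, h' => v; rewrite h'E {2}[v]bE; apply: eq_bigr => k _; rewrite hE mxE.
Qed.

Lemma fg_vect F : fg F.
Proof.
have [n [h [h' hK]]] := vect_retract F; exists n, h' => v.
by exists (h v).
Qed.

Lemma vanish_vect (E : injres R) F : vanish E F 1.
Proof.
have [n [h [h' hK]]] := vect_retract F.
exact: vanish_retract hK (@vanish_free R E n).
Qed.

Lemma eval_dual F (chi : {linear 'Hom(F, R^o) -> R^o}) :
  exists u, forall phi, chi phi = phi u.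
Proof.
have [n [b [c [bE _]]]] := dual_basis F; exists (\sum_k chi (c k) *: b k) => phi.
rewrite {1}(dual_basisE bE phi) !linear_sum; apply: eq_bigr => k _.
by rewrite !linearZ_LR; apply: mulrC.
Qed.

Lemma dual_qmul F x j (v : F) :
  (forall phi : 'Hom(F, R^o), qmul x j (phi v)) -> qmul x j v.
Proof.
have [n [b [c [bE _]]]] := dual_basis F => h; rewrite [v]bE.
by apply: (submod_sum (qmul_submod _ x j)) => k _; apply: qmulZ; apply: h.
Qed.

Lemma qmul_dual F x j (phi : 'Hom(F, R^o)) :
  (forall v, qmul x j (phi v)) <-> qmul x j phi.
Proof.
split=> h; last first.
  move=> v; have [f fE] : exists f : {linear 'Hom(F, R^o) -> R^o}, forall p, f p = p v.
    by apply: linP => a p q; rewrite add_lfunE scale_lfunE.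
  by rewrite -fE; apply: qmul_lin.
have [n [b [c [bE _]]]] := dual_basis F; rewrite (dual_basisE bE phi).
by apply: (submod_sum (qmul_submod _ x j)) => k _; apply: qmulZ; apply: h.
Qed.

End DualBasis.

Section Lifting.
Variables (R : comNzRingType) (m : idealr R) (E : injres R) (x : seq R) (n : nat).
Hypotheses (noethR : noetherian R) (locR : local_ring m).
Hypothesis finite_vanish : forall N : lmodType R, fg N -> vanish E N n.+1.
Hypothesis xm : forall i, (i < n)%N -> x`_i \in m.
Hypothesis xreg : wreg R^o x n.

Lemma vanish_ker (A B C : lmodType R) (f : {linear A -> B}) (g : {linear B -> C}) c :
  ses f g -> vanish E B c -> vanish E C c -> vanish E A c.
Proof.
move=> hs hB hC i ci; apply: (ext_sub hs); first exact: hB.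
by apply: hC; apply: leqW.
Qed.

(* Every map X -> R / (x_0, .., x_(j-1)) lifts to R.  The map is given on a
   cover F of X; dividing its restriction to the kernel by x_j gives a map to
   R / (x_0, .., x_(j-1)), which lifts by induction. *)
Lemma lift_mod j (F X : lmodType R) (eps : {linear F -> X}) (phi : {linear F -> R^o}) :
  (j <= n)%N -> fg F -> vanish E F 1 -> vanish E X 1 ->
  (forall y, exists u, eps u = y) -> (forall u, eps u = 0 -> qmul x j (phi u)) ->
  exists th : {linear X -> R^o}, forall u, qmul x j (phi u - th (eps u)).
Proof.
elim: j F X eps phi => [|j IH] F X eps phi lj fgF vF vX es hphi.
  have [th thE] := factor_surj es hphi; exists th => u.
  by rewrite /= thE subrr.
have [K [f [fi fE]]] := sub_exists (ker_submod eps).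
have hs : ses f eps by [].
have ef k : eps (f k) = 0 by apply/fE; exists k.
have [g [p ps]] := fg_sub noethR fi fgF.
have /boolp.choice[c cE] (l : 'I_g) :
    exists u : R^o, qmul x j (phi (f (p (delta_mx 0 l))) - x`_j *: u).
  exact: (hphi _ (ef _)).
have hQ := qmul_submod R^o x j.
have [psi psiE] := row_hom c.
have psiP v : qmul x j (phi (f (p v)) - x`_j *: psi v).
  rewrite psiE -[phi _]/((phi \o f) (p v)) row_hom_compE /= scaler_sumr -sumrB.
  apply: (submod_sum hQ) => l _; rewrite scalerA mulrC -scalerA -scalerBr.
  exact: (submodZ hQ).
(* [psi] is [phi] divided by x_j on generators of [K]. It kills their relations modulo the earlier
   elements because x_j is regular. *)
have [|th thE] := IH _ K p psi (ltnW lj) (fg_row R g) (@vanish_free R E g)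
    (vanish_ker hs vF vX) ps.
  move=> v pv; apply: xreg lj _ _; have := psiP v.
  by rewrite pv !linear0 sub0r => /(submodN hQ); rewrite opprK.
have [chi chiE] := ext1_extend hs th (vX 1%N isT).
(* Subtracting x_j times the extended lift makes [phi] vanish on the kernel modulo x_0, .., x_(j-1),
   so that the induction hypothesis applies to X itself. *)
have [|th' th'E] := IH _ _ eps (phi \- (x`_j \*: chi)) (ltnW lj) fgF vF vX es.
  move=> _ /fE[k <-] /=; have [v <-] := ps k; rewrite chiE.
  have -> : phi (f (p v)) - x`_j *: th (p v) =
      (phi (f (p v)) - x`_j *: psi v) + x`_j *: (psi v - th (p v)).
    by rewrite scalerBr addrA subrK.
  by apply: (submodD hQ) => //; apply: (submodZ hQ).
exists th' => u /=; exists (chi u); rewrite addrAC.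
exact: th'E.
Qed.

Section Presentation.
Variables (F1 F0 : vectType R) (M T : lmodType R) (d : 'Hom(F1, F0)).
Variables (eps : {linear F0 -> M}) (pi : {linear 'Hom(F1, R^o) -> T}).
Hypothesis vM : vanish E M 1.
Hypothesis eps_surj : forall y, exists u, eps u = y.
Hypothesis eps_ker : forall u, eps u = 0 <-> exists v, d v = u.
Hypothesis pi_surj : forall y, exists psi, pi psi = y.
Hypothesis pi_ker : forall psi, pi psi = 0 <-> exists phi, dual d phi = psi.

(** [phi] induces a map from M = F0 / im d to R / (x_0, .., x_(j-1)); [th] is a lift of it, pulled
    back to F0. *)
Lemma dual_lift j (phi : 'Hom(F0, R^o)) : (j <= n)%N ->
  (forall v, qmul x j (phi (d v))) ->
  exists2 th : 'Hom(F0, R^o), dual d th = 0 & qmul x j (phi - th).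
Proof.
move=> lj h.
have [|th thE] := lift_mod (phi := phi) lj (fg_vect F0) (@vanish_vect R E F0) vM eps_surj.
  by move=> u /eps_ker[v <-]; apply: h.
have [t tE] := lfun_exists (th \o eps); exists t.
  apply/lfunP => v; rewrite comp_lfunE tE /= zero_lfunE.
  by rewrite (_ : eps (d v) = 0) ?linear0 //; apply/eps_ker; exists v.
apply/qmul_dual => v; rewrite add_lfunE opp_lfunE tE; exact: thE.
Qed.

(** If x_i psi agrees with [dual d phi] modulo the earlier elements, then psi maps ker d into their
    ideal, because phi d is zero there and x_i is regular. So psi induces a map on im d, which lifts
    to R and extends to F0 since Ext^1(M, R) = 0. Removing the pullback of this extension does not
    change the class of psi in Tr M. *)
Lemma transpose_wreg : wreg T x n.
Proof.
move=> i lt y; have [psi <-] := pi_surj y; rewrite -linearZ_LR.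
move=> /(qmul_lift pi_surj)[psi' qpsi'] /eqP; rewrite eq_sym -subr_eq0 -linearB.
move=> /eqP/pi_ker[phi phiE].
have [N [f [fi fE]]] := sub_exists (ker_submod eps).
have hs : ses f eps by [].
have [d' d'E] : exists d' : {linear F1 -> N}, forall v, f (d' v) = d v.
  by apply: (factor_inj fi) => v; apply/fE/eps_ker; exists v.
have d's w : exists v, d' v = w.
  have /eps_ker[v vE] : eps (f w) = 0 by apply/fE; exists w.
  by exists v; apply: fi; rewrite d'E.
have hQ := qmul_submod R^o x i.
have [|th thE] := lift_mod (phi := psi) (ltnW lt) (fg_vect F1) (@vanish_vect R E F1)
    (vanish_ker hs (@vanish_vect R E F0) vM) d's.
  move=> v dv; apply: (xreg lt); have /qmul_dual/(_ v) := qpsi'.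
  have -> : psi' = x`_i *: psi - dual d phi by rewrite phiE opprB addrC subrK.
  rewrite !(add_lfunE, opp_lfunE, scale_lfunE) comp_lfunE -d'E dv !linear0 addr0.
  by [].
have [chi chiE] := ext1_extend hs th (vM (leqnn 1)).
have [ch chE] := lfun_exists chi.
have -> : pi psi = pi (psi - dual d ch).
  rewrite linearB (_ : pi (dual d ch) = 0) ?subr0 //.
  by apply/pi_ker; exists ch.
apply: qmul_lin; apply/qmul_dual => v.
rewrite !(add_lfunE, opp_lfunE) comp_lfunE chE -d'E chiE; exact: thE.
Qed.

Lemma transpose_vanish : vanish E T 1.
Proof.
have fgT := fg_surj pi_surj (fg_vect 'Hom(F1, R^o)).
have := wreg_vanish noethR locR finite_vanish fgT transpose_wreg xm.
by rewrite subSnn.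
Qed.

(** Evaluation at [v] induces a map from the image of [dual d] to R / (x_0, .., x_(j-1)). Its lift
    to R extends to the dual of F1 since Ext^1(Tr M, R) = 0, and is there evaluation at some [u] by
    reflexivity. *)
Lemma double_dual_lift j v : (j <= n)%N ->
  (forall phi : 'Hom(F0, R^o), dual d phi = 0 -> qmul x j (phi v)) ->
  exists u, qmul x j (v - d u).
Proof.
move=> lj h.
have [L [f [fi fE]]] := sub_exists (ker_submod pi).
have hs : ses f pi by [].
have [p pE] : exists p : {linear 'Hom(F0, R^o) -> L}, forall phi, f (p phi) = dual d phi.
  by apply: (factor_inj fi) => phi; apply/fE/pi_ker; exists phi.
have psurj w : exists phi, p phi = w.
  have /pi_ker[phi e] : pi (f w) = 0 by apply/fE; exists w.
  by exists phi; apply: fi; rewrite pE.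
have [ev evE] : exists ev : {linear 'Hom(F0, R^o) -> R^o}, forall phi, ev phi = phi v.
  by apply: linP => a p1 p2; rewrite add_lfunE scale_lfunE.
have [|th thE] := lift_mod (phi := ev) lj (fg_vect _) (@vanish_vect R E _)
    (vanish_ker hs (@vanish_vect R E _) transpose_vanish) psurj.
  by move=> phi p0; rewrite evE; apply: h; rewrite -pE p0 linear0.
have [chi chiE] := ext1_extend hs th (transpose_vanish (leqnn 1)).
have [u uE] := eval_dual chi; exists u; apply: dual_qmul => phi.
by have := thE phi; rewrite evE -chiE uE pE comp_lfunE linearB.
Qed.

End Presentation.
End Lifting.

(** * Ulrich ideals *)

Section FreeReduction.
Variables (R : comNzRingType) (I : idealr R) (M : lmodType R).
Local Notation IM := (pmul I (full M)).
Let p (y : M) : redmod I M := \pi_(quot_module IM) y.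
Let q : {rmorphism R -> {ideal_quot I}} := \pi_({ideal_quot I}).

Let p0 y : p y = 0 <-> y \in IM. Proof. exact: pi_eq0. Qed.
Let pD y z : p (y + z) = p y + p z. Proof. exact: raddfD. Qed.
Let pZ a y : p (a *: y) = q a *: p y.
Proof.
rewrite -[q a *: _]/(red_scale _ _) red_scaleE.
by rewrite -[a *: _ in RHS]/(quot_scale a _) quot_scaleE.
Qed.
Let p_surj z : exists y, p y = z.
Proof. by exists (repr (z : quot_module IM)); rewrite /p reprK. Qed.
Let q0 a : q a = 0 <-> a \in I.
Proof.
rewrite -(rmorph0 q) -[a in a \in I]subr0 Quotient.idealrBE.
by split=> /eqP.
Qed.
Let q_surj z : exists a, q a = z.
Proof. by exists (repr z); exact: reprK. Qed.
Let p_sum (n : nat) (F : 'I_n -> M) : p (\sum_k F k) = \sum_k p (F k).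
Proof. by elim/big_rec2: _ => [|k y z _ <-]; [apply/p0; exact: rpred0|rewrite pD]. Qed.

(** This removes the quotient ring: freeness over R / I becomes a statement about coefficients in
    R. *)
Lemma free_redmodP : free_module (redmod I M) <->
  exists n (b : 'I_n -> M),
    (forall y, exists c : 'I_n -> R, y - \sum_k c k *: b k \in IM) /\
    forall c : 'I_n -> R, \sum_k c k *: b k \in IM -> forall k, c k \in I.
Proof.
have pB y z : p (y - z) = p y - p z by rewrite pD -scaleN1r pZ rmorphN1 scaleN1r.
split=> [[n [f [g fK gK]]]|[n [b [gen ind]]]].
  have /boolp.choice[b bE] (k : 'I_n) := p_surj (f (delta_mx 0 k)).
  have fE (c : 'I_n -> R) : p (\sum_k c k *: b k) = f (\row_k q (c k)).
    rewrite p_sum row_homE; apply: eq_bigr => k _.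
    by rewrite pZ bE mxE.
  exists n, b; split=> [y|c /p0].
    have /boolp.choice[c cE] (k : 'I_n) := q_surj (g (p y) 0 k).
    exists c; apply/p0; rewrite pB fE (_ : \row_k _ = g (p y)) ?gK ?subrr //.
    by apply/rowP => k; rewrite mxE cE.
  rewrite fE => f0 k; apply/q0.
  have := congr1 g f0; rewrite fK -(linear0 f) fK => /rowP/(_ k).
  by rewrite !mxE.
have [f fE] := row_hom (fun k => p (b k)).
have fq (c : 'I_n -> R) : f (\row_k q (c k)) = p (\sum_k c k *: b k).
  by rewrite fE p_sum; apply: eq_bigr => k _; rewrite mxE pZ.
have rep v : exists c : 'I_n -> R, v = \row_k q (c k).
  have /boolp.choice[c cE] (k : 'I_n) := q_surj (v 0 k).
  by exists c; apply/rowP => k; rewrite mxE cE.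
exists n, f.
have fi : injective f.
  move=> u v e; apply/eqP; rewrite -subr_eq0.
  have [c cE] := rep (u - v); have : f (u - v) = 0 by rewrite linearB e subrr.
  rewrite cE fq => /p0/ind h; apply/eqP/rowP => k; rewrite !mxE.
  exact/q0.
have fs y : exists v, f v = y.
  have [z <-] := p_surj y; have [c] := gen z; move=> /p0; rewrite pB => /eqP.
  by rewrite subr_eq0 => /eqP->; exists (\row_k q (c k)); rewrite fq.
have [g gE] := boolp.choice fs; exists g => // v.
by apply: fi; rewrite gE.
Qed.

End FreeReduction.

Lemma residue_field (R : comNzRingType) (m : idealr R) :
  noetherian R -> local_ring m ->
  exists (K : fieldType) (pi : {rmorphism R -> K}),
    (forall y, exists a, pi a = y) /\ forall a, pi a = 0 <-> a \in m.
Proof.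
move=> noethR locR; pose p : {rmorphism R -> {ideal_quot m}} := \pi_({ideal_quot m}).
have p0 a : p a = 0 <-> a \in m.
  rewrite -(rmorph0 p) -[a in a \in m]subr0 Quotient.idealrBE.
  by split=> /eqP.
have ps y : exists a, p a = y by exists (repr y); exact: reprK.
have inv_ex (y : {ideal_quot m}) : exists z, (y != 0 -> z * y = 1) /\ (y = 0 -> z = 0).
  have [->|ne] := eqVneq y 0; first by exists 0.
  have [a aE] := ps y; have am : a \notin m.
    by apply/negP => /p0 e; rewrite -aE e eqxx in ne.
  have [b be] := local_unit noethR locR am; exists (p b).
  by split=> [_|e]; [rewrite -aE -rmorphM be rmorph1|rewrite e eqxx in ne].
have [inv hinv] := boolp.choice inv_ex.
have mulVf (y : {ideal_quot m}) : y != 0 -> inv y * y = 1 by case: (hinv y).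
have inv0 : inv 0 = 0 by case: (hinv 0) => _; apply.
pose K : fieldType := HB.pack {ideal_quot m}
  (GRing.ComNzRing_isField.Build {ideal_quot m} mulVf inv0).
by exists K, p.
Qed.

(** Over the residue field X has independent rows, hence a right inverse. A lift P of it satisfies X
    P = 1 modulo m, and X P is therefore invertible. *)
Lemma left_inverse_mod (R : comNzRingType) (m : idealr R) d n (X : 'M[R]_(d, n)) :
  noetherian R -> local_ring m ->
  (forall w : 'rV[R]_d, (forall k, (w *m X) 0 k \in m) -> forall i, w 0 i \in m) ->
  exists P : 'M[R]_(n, d), X *m P = 1%:M.
Proof.
move=> noethR locR hX; have [K [p [ps p0]]] := residue_field noethR locR.
have lift a b (A : 'M[K]_(a, b)) : exists B, map_mx p B = A.
  have /boolp.choice[f fE] (ij : 'I_a * 'I_b) := ps (A ij.1 ij.2).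
  by exists (\matrix_(i, j) f (i, j)); apply/matrixP => i j; rewrite !mxE fE.
have /row_freeP[B BE] : row_free (map_mx p X).
  apply: inj_row_free => v; have [w <-] := lift _ _ v; rewrite -map_mxM => e.
  apply/rowP => i; rewrite !mxE; apply/p0; apply: hX => k; apply/p0.
  by have /rowP/(_ k) := e; rewrite !mxE.
have [P PE] := lift _ _ B.
pose C := 1%:M - X *m P.
have [|D _ DE] := @inv_1Bmx _ m noethR locR _ C.
  move=> i j; apply/p0; have := congr1 (fun A : 'M_d => A i j) BE.
  rewrite -PE -map_mxM [LHS]mxE => e.
  by rewrite /C mxE [X in _ + X]mxE rmorphB e [in X in X - _]mxE rmorph_nat mxE subrr.
by exists (P *m D); rewrite mulmxA -DE /C opprB addrC subrK.
Qed.

Section UlrichIdeal.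
Variables (R : comNzRingType) (m : idealr R) (I : idealr R) (x : seq R).
Hypotheses (noethR : noetherian R) (locR : local_ring m).
Hypotheses (hI : m_primary m I) (xreg : wreg R^o x (size x)).
Hypotheses (QI : {subset pideal x <= I}) (IQ : ~ {subset I <= pideal x}).
Hypothesis hIU : ulrich_ideal (pideal x) I.

(** The ideal Q I, with one coefficient in I for each generator of Q, the form to which
    [wreg_relation] applies. *)
Definition prodQI (y : R) := exists2 t : nat -> R, (forall i, t i \in I) &
  y = \sum_(i < size x) t i * x`_i.

Lemma prodQI_ideal : is_ideal prodQI.
Proof.
split.
  exists (fun=> 0) => [i|]; first exact: rpred0.
  by rewrite big1 // => i _; rewrite mul0r.
move=> a u v [t tI ->] [s sI ->]; exists (fun i => a * t i + s i).
  by move=> i; apply: rpredD => //; apply: idealMr.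
rewrite -[_ *: _]/(_ * _) mulr_sumr -big_split; apply: eq_bigr => i _ /=.
by rewrite mulrDl mulrA.
Qed.

Lemma prodQI_mem i u : (i < size x)%N -> u \in I -> prodQI (x`_i * u).
Proof.
move=> lt uI; exists (fun j => if j == i then u else 0) => [j|].
  by case: ifP => // _; apply: rpred0.
rewrite (bigD1 (Ordinal lt)) //= eqxx mulrC big1 ?addr0 // => j ne.
by rewrite ifN ?mul0r //; apply: contraNneq ne => e; apply/eqP/val_inj.
Qed.

Lemma ideal_sq a b : a \in I -> b \in I -> prodQI (a * b).
Proof.
move=> aI bI; have mem (N : {pred R}) u v : u \in I -> v \in N -> u * v \in imul I N.
  move=> uI vN; apply/asboolP; exists [:: (u, v : R^o)]; last by rewrite big_seq1.
  by move=> p; rewrite inE => /eqP->.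
have : a * b \in ipow I 2.
  by apply: (mem (imul I predT)) => //; rewrite -[b]mulr1; apply: mem.
rewrite hIU.1 => /asboolP[s hs ->]; rewrite big_seq.
apply: (submod_sum prodQI_ideal) => -[q u] /hs[/= qQ uI].
move: q qQ {hs}; apply: (span_sub (M := R^o) (submod_ideal (u : R^o) prodQI_ideal)).
by move=> q /(nthP 0)[i lt <-]; apply: prodQI_mem.
Qed.

(** The x_i are independent over R / I modulo Q I: two expressions of one element differ by a
    relation, whose coefficients lie in Q and so in I. *)
Lemma prodQI_coef (c : nat -> R) : prodQI (\sum_(i < size x) c i * x`_i) ->
  forall i, (i < size x)%N -> c i \in I.
Proof.
move=> [t tI e] i lt; rewrite -(subrK (t i) (c i)); apply: rpredD => //.
apply: QI; apply/qmul_ideal.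
apply: (wreg_relation (c := fun i => c i - t i) xreg) lt.
by under eq_bigr do rewrite mulrBl; rewrite sumrB e subrr.
Qed.

(** A basis of I / I^2 over R / I lifted to I, with Q I in place of I^2. *)
Lemma ulrich_basis : exists n (b : 'I_n -> R),
  [/\ forall k, b k \in I,
      forall u, u \in I -> exists c : 'rV[R]_n, prodQI (u - \sum_k c 0 k * b k) &
      forall c : 'rV[R]_n, prodQI (\sum_k c 0 k * b k) -> forall k, c 0 k \in I].
Proof.
have vl : linear (fun z : ideal_module I => val z : R^o) by move=> a u v.
pose f := mklin vl; have fS u (uI : u \in I) : f (Sub u uI) = u by exact: SubK.
have memP z : z \in pmul I (full (ideal_module I)) <-> prodQI (f z).
  split; last first.
    move=> [t tI zE]; have hP := pmul_submod (ideal_module I) I.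
    have -> : z = \sum_(i < size x) x`_i *: (Sub (t i) (tI i) : ideal_module I).
      apply: val_inj; rewrite -[LHS]/(f z) -[RHS]/(f _) zE linear_sum.
      by apply: eq_bigr => i _; rewrite linearZ_LR fS; apply: mulrC.
    apply: (submod_sum hP) => i _; apply: mem_pmul; apply: QI.
    by apply: (mem_span (M := R^o)); apply: mem_nth.
  apply: (pmul_sub (P := fun z => prodQI (f z)) (preim_submod f prodQI_ideal)) => a u aI.
  by rewrite linearZ_LR; apply: ideal_sq => //; apply: (valP u).
have [n [b [gen ind]]] := (free_redmodP I (ideal_module I)).1 hIU.2.
have fE (c : 'I_n -> R) : f (\sum_k c k *: b k) = \sum_k c k * f (b k).
  by rewrite linear_sum; apply: eq_bigr => k _; rewrite linearZ_LR.
exists n, (fun k => f (b k)); split=> [k|u uI|c hc k]; first exact: (valP (b k)).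
  have [c] := gen (Sub u uI); move=> /memP; rewrite linearB fE.
  rewrite fS => h; exists (\row_k c k); move: h; congr (prodQI (_ - _)).
  by apply: eq_bigr => k _; rewrite mxE.
by apply: (ind (c 0)) => //; apply/memP; rewrite fE.
Qed.

(* Q : I = I.  The elements x_i are part of a basis of I / I^2 over R / I, and
   I / I^2 has a further basis element because I is not contained in Q. *)
Lemma colon_ulrich c : (forall u, u \in I -> c * u \in pideal x) -> c \in I.
Proof.
move=> hc; apply: contrapT => cI; apply: IQ.
have [n [b [bI gen ind]]] := ulrich_basis.
have hQI := prodQI_ideal; set d := size x.
have xI (i : 'I_d) : x`_i \in I.
  by apply: QI; apply: (mem_span (M := R^o)); apply: mem_nth.
(* Row i of X holds the coordinates of x_i in the basis b modulo Q I. *)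
have /boolp.choice[X0 X0E] (i : 'I_d) := gen _ (xI i).
pose X := \matrix_(i, k) X0 i 0 k.
have XE (w : 'rV_d) : prodQI (\sum_(i < d) w 0 i * x`_i - \sum_k (w *m X) 0 k * b k).
  have -> : \sum_k (w *m X) 0 k * b k = \sum_(i < d) w 0 i * \sum_k X0 i 0 k * b k.
    under eq_bigr do rewrite mxE mulr_suml; rewrite exchange_big.
    apply: eq_bigr => i _; rewrite mulr_sumr; apply: eq_bigr => k _.
    by rewrite mxE mulrA.
  rewrite -sumrB; apply: (submod_sum hQI) => i _.
  by rewrite -mulrBr; apply: (is_idealMl _ hQI).
(* X is injective modulo m. Take s outside I with m s in I, a socle element of R / I. If w X has
   entries in m, then s times the combination of the x_i with coefficients w lies in Q I, so each s
   w_i lies in I and w_i in m. *)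
have [P PE] : exists P : 'M_(n, d), X *m P = 1%:M.
  apply: (left_inverse_mod noethR locR) => w wm.
  have n1 : ~ ((1 : R^o) \in I) by rewrite idealr1.
  have [a aI|s sE] := torsion_socle noethR locR (idealr_ideal I) n1 hI _.
    by rewrite -[a *: _]/(a * 1) mulr1.
  rewrite [s *: _](_ : _ = s) in sE; last exact: mulr1.
  move=> i; apply/sE; rewrite -[_ *: _]/(_ * _).
  pose g (k : nat) := if insub k is Some l then w 0 (l : 'I_d) * s else 0.
  have gE (j : 'I_d) : g j = w 0 j * s by rewrite /g valK.
  rewrite -gE; apply: (prodQI_coef (c := g) _ (ltn_ord i)).
  under eq_bigr do rewrite gE.
  have -> : \sum_(j < d) w 0 j * s * x`_j =
      s * (\sum_(j < d) w 0 j * x`_j - \sum_k (w *m X) 0 k * b k) +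
      \sum_k (s * (w *m X) 0 k) * b k.
    rewrite mulrBr; under [X in _ - _ + X]eq_bigr do rewrite -mulrA.
    rewrite -mulr_sumr subrK mulr_sumr; apply: eq_bigr => j _.
    by rewrite [w 0 j * s]mulrC mulrA.
  apply: (submodD hQI); first exact: (is_idealMl _ hQI).
  apply: (submod_sum hQI) => k _; apply: ideal_sq => //.
  by rewrite mulrC; apply/sE.
(* The part w of v complementary to the span of the x_i satisfies w P = 0. As c maps I into Q, c w =
   q X modulo I for some q; multiplying by P gives q = 0 modulo I, so c w has entries in I. A unit
   entry of w would put c into I. *)
have key u : u \in I -> exists v w : 'rV[R]_n, [/\ forall k, w 0 k \in m,
    prodQI (u - \sum_k (v + w) 0 k * b k) & exists q, v = q *m X].
  move=> uI; have [v vE] := gen u uI; pose w := v - v *m P *m X.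
  exists (v *m P *m X), w; rewrite /w [v *m P *m X + _]addrC subrK.
  split=> //; last by exists (v *m P).
  have wI : \sum_k w 0 k * b k \in I.
    by apply: rpred_sum => k _; apply: idealMr.
  have [q qE] : exists q : 'rV[R]_d, c * (\sum_k w 0 k * b k) = \sum_(i < d) q 0 i * x`_i.
    by have /spanP[q qE] := hc _ wI; exists q; rewrite qE.
  have cw k : (c *: w - q *m X) 0 k \in I.
    move: k; apply: ind.
    have -> : \sum_k (c *: w - q *m X) 0 k * b k =
        \sum_(i < d) q 0 i * x`_i - \sum_k (q *m X) 0 k * b k.
      rewrite -qE mulr_sumr -sumrB; apply: eq_bigr => k _.
      by rewrite !mxE mulrDl mulNr mulrA.
    exact: XE.
  have wP : w *m P = 0 by rewrite mulmxBl -!mulmxA PE mulmx1 subrr.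
  have qI i : q 0 i \in I.
    have -> : q = - ((c *: w - q *m X) *m P).
      by rewrite mulmxBl -scalemxAl wP scaler0 sub0r opprK -mulmxA PE mulmx1.
    rewrite mxE rpredN mxE.
    by apply: rpred_sum => k _; rewrite mulrC idealMr.
  move=> k; apply: contrapT => wm; apply: cI.
  have [a aw] := local_unit noethR locR (introN idP wm).
  rewrite -[c]mulr1 -aw mulrCA idealMr //.
  have := cw k; rewrite !mxE => h.
  rewrite -[c * _](subrK (\sum_i q 0 i * X i k)) rpredD //.
  by apply: rpred_sum => i _; rewrite mulrC idealMr.
have vl : linear (fun z : ideal_module I => val z : R^o) by move=> a u v.
pose f := mklin vl; have fS u (uI : u \in I) : f (Sub u uI) = u by exact: SubK.
have hQ := pideal_ideal x.
have fgI : fg (ideal_module I).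
  by apply: (fg_sub noethR (f := f)); [exact: val_inj|exact: fg_ring].
(* [key] shows I contained in Q + m I, since q X represents an element of Q modulo Q I. *)
have all := nakayama noethR locR fgI (preim_submod f hQ) _.
move=> u uI; rewrite -(fS u uI); apply: all => {u uI} y.
have [v [w [wm hvw [q qE]]]] := key (f y) (valP y).
exists (\sum_k w 0 k *: (Sub (b k) (bI k) : ideal_module I)).
  apply: (submod_sum (pmul_submod (ideal_module I) m)) => k _.
  exact: mem_pmul.
rewrite linearB linear_sum.
have sub t : prodQI t -> t \in pideal x.
  move=> [t' _ ->]; apply: (submod_sum hQ) => i _; apply: (is_idealMl _ hQ).
  by apply: (mem_span (M := R^o)); apply: mem_nth.
have -> : f y - \sum_k f (w 0 k *: (Sub (b k) (bI k) : ideal_module I)) =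
    (f y - \sum_k (v + w) 0 k * b k) -
    (\sum_(i < d) q 0 i * x`_i - \sum_k (q *m X) 0 k * b k) +
    \sum_(i < d) q 0 i * x`_i.
  rewrite opprB addrA subrK -qE -addrA; congr (_ + _).
  rewrite [- _ + _]addrC -opprB; congr (- _).
  rewrite -sumrB; apply: eq_bigr => k _; rewrite linearZ_LR fS.
  by rewrite mxE mulrDl addrAC subrr add0r.
apply: (submodD hQ); first by apply: (submodB hQ); apply: sub; [exact: hvw|exact: XE].
apply: (submod_sum hQ) => i _; apply: (is_idealMl _ hQ).
by apply: (mem_span (M := R^o)); apply: mem_nth.
Qed.

End UlrichIdeal.

(** * Ulrich modules and minimal covers *)

Section FreeCovers.
Variables (R : comNzRingType) (m : idealr R).
Hypotheses (noethR : noetherian R) (locR : local_ring m).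
Implicit Types (F G : vectType R) (I : idealr R).

Lemma pmul_vect F I (v : F) :
  v \in pmul I (full F) <-> forall phi : 'Hom(F, R^o), phi v \in I.
Proof.
split=> [vI phi|h].
  apply: (pmul_sub (preim_submod phi (idealr_ideal I))) vI => a u aI.
  by rewrite linearZ_LR -[_ *: _]/(a * _) mulrC idealMr.
have [n [b [c [bE _]]]] := dual_basis F; rewrite [v]bE.
apply: (submod_sum (pmul_submod F I)) => k _; apply: mem_pmul.
exact: h.
Qed.

Lemma pmul_dual F I (phi : 'Hom(F, R^o)) :
  phi \in pmul I (full 'Hom(F, R^o)) <-> forall v, phi v \in I.
Proof.
split=> [hI v|h].
  pose P (p : 'Hom(F, R^o)) := p v \in I.
  have hP : is_submod P.
    rewrite /P; split=> [|a p p' pv p'v]; first by rewrite zero_lfunE; exact: rpred0.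
    rewrite add_lfunE scale_lfunE rpredD // -[_ *: _]/(a * _).
    exact: idealMr.
  apply: (pmul_sub hP) hI => a p aI.
  by rewrite /P scale_lfunE -[_ *: _]/(a * _) mulrC idealMr.
have [n [b [c [bE _]]]] := dual_basis F; rewrite (dual_basisE bE phi).
apply: (submod_sum (pmul_submod _ I)) => k _; apply: mem_pmul.
exact: h.
Qed.

Lemma near_id_bij F (th : {linear F -> F}) :
  (forall v, th v - v \in pmul m (full F)) ->
  injective th /\ forall v, exists u, th u = v.
Proof.
move=> hth; have [n [b [c [bE cb]]]] := dual_basis F.
pose C := \matrix_(k, l) c l (b k - th (b k)).
have [|B BC CB] := @inv_1Bmx _ m noethR locR _ C.
  move=> k l; rewrite mxE; move: (c l); apply/pmul_vect.
  by rewrite -opprB; apply: (submodN (pmul_submod F m)).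
have cth v l : c l (th v) = ((\row_k c k v) *m (1%:M - C)) 0 l.
  rewrite {1}[v]bE !linear_sum mxE; apply: eq_bigr => k _.
  by rewrite !linearZ_LR !mxE linearB /= cb [l == k]eq_sym subKr.
have sep v w : (forall l, c l v = c l w) -> v = w.
  by move=> h; rewrite [v]bE [w]bE; apply: eq_bigr => l _; rewrite h.
split=> [u v e|v].
  have e' : (\row_k c k u) *m (1%:M - C) = (\row_k c k v) *m (1%:M - C).
    by apply/rowP => l; rewrite -!cth e.
  apply: sep => l; have := congr1 (fun A => (A *m B) 0 l) e'.
  by rewrite /= -!mulmxA CB !mulmx1 !mxE.
exists (\sum_k ((\row_k c k v) *m B) 0 k *: b k); apply: sep => l.
rewrite cth (_ : \row_k _ = (\row_k c k v) *m B).
  by rewrite -mulmxA BC mulmx1 mxE.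
apply/rowP => j; rewrite mxE linear_sum (bigD1 j) //= big1 ?addr0 => [|k kj].
  by rewrite linearZ_LR /= cb eqxx; apply: mulr1.
by rewrite linearZ_LR /= cb eq_sym (negPf kj); apply: mulr0.
Qed.

Lemma vect_lift F (N T : lmodType R) (p : {linear F -> T}) (q : {linear N -> T}) :
  (forall y, exists u, q u = y) -> exists h : {linear F -> N}, forall v, q (h v) = p v.
Proof.
move=> qs; have [n [b [c [bE _]]]] := dual_basis F.
have /boolp.choice[s sE] (k : 'I_n) := qs (p (b k)).
have [h hE] : exists h : {linear F -> N}, forall v, h v = \sum_k c k v *: s k.
  apply: linP => a u v; rewrite scaler_sumr -big_split; apply: eq_bigr => k _ /=.
  by rewrite linearP scalerDl scalerA.
exists h => v; rewrite hE {2}[v]bE !linear_sum; apply: eq_bigr => k _.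
by rewrite !linearZ_LR sE.
Qed.

(** Lift each cover through the other; by minimality both composites are the identity modulo m,
    hence bijective. *)
Lemma minimal_cover_unique F G (T : lmodType R) (p : {linear F -> T}) (q : {linear G -> T}) :
  (forall y, exists u, p u = y) -> (forall y, exists u, q u = y) ->
  (forall u, p u = 0 -> u \in pmul m (full F)) ->
  (forall u, q u = 0 -> u \in pmul m (full G)) ->
  exists h : {linear F -> G},
    [/\ forall v, q (h v) = p v, injective h & forall w, exists v, h v = w].
Proof.
move=> ps qs pm qm; have [h hE] := vect_lift p qs; have [h' h'E] := vect_lift q ps.
have [|i1 _] := @near_id_bij _ (h' \o h).
  by move=> v; apply: pm; rewrite linearB /= h'E hE subrr.
have [|_ s2] := @near_id_bij _ (h \o h').
  by move=> v; apply: qm; rewrite linearB /= hE h'E subrr.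
exists h; split=> // [u v e|w]; first by apply: i1; rewrite /= e.
by have [u <-] := s2 w; exists (h' u).
Qed.

Section Criterion.
Variables (I : idealr R) (x : seq R).
Hypotheses (Im : {subset I <= m}) (QI : {subset pideal x <= I}).
Variables (F : vectType R) (X : lmodType R) (eps : {linear F -> X}).
Hypothesis eps_surj : forall y, exists u, eps u = y.

(** I F = ker eps + Q F. Only F and the kernel occur, so the condition can be compared between F0
    and its dual. *)
Definition ulrich_cover := forall v : F, v \in pmul I (full F) <->
  exists2 k, eps k = 0 & qmul x (size x) (v - k).

Let pmul_eps y : y \in pmul I (full X) <-> exists2 v, v \in pmul I (full F) & eps v = y.
Proof.
split=> [|[v vI <-]].
  move: y; apply: pmul_sub => [|a y aI].
    apply: lin_image_submod; exact: pmul_submod.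
  by have [v <-] := eps_surj y; exists (a *: v); [apply: mem_pmul|rewrite linearZ_LR].
apply: (pmul_sub (preim_submod eps (pmul_submod X I))) vI => a u aI.
by rewrite linearZ_LR; apply: mem_pmul.
Qed.

Let qmulP (N : lmodType R) (y : N) : qmul x (size x) y <-> y \in pmul (pideal x) (full N).
Proof. by rewrite qmulE // take_size. Qed.

Let qmul_pmul (N : lmodType R) (y : N) : qmul x (size x) y -> y \in pmul I (full N).
Proof.
apply: (qmul_min (pmul_submod N I)) => i u lt; apply: mem_pmul; apply: QI.
by apply: (mem_span (M := R^o)); apply: mem_nth.
Qed.

(** The kernel of eps lies in I F, so X / I X = F / I F and a basis of F maps to a basis. *)
Lemma ulrich_cover_ulrich : ulrich_cover ->
  pmul I (full X) =i pmul (pideal x) (full X) /\ free_module (redmod I X).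
Proof.
move=> hU; have kI v : eps v \in pmul I (full X) -> v \in pmul I (full F).
  move=> /pmul_eps[w /hU[k k0 wk] e]; apply/hU; exists (v - w + k).
    by rewrite linearD linearB e subrr k0 addr0.
  by rewrite opprD opprB addrA [v + _]addrC subrK.
split=> [y|].
  apply/idP/idP => [/pmul_eps[v /hU[k k0 vk] <-]|].
    by apply/qmulP; rewrite -[eps v]subr0 -k0 -linearB; apply: qmul_lin.
  by move=> /qmulP; apply: qmul_pmul.
have [n [b [c [bE cb]]]] := dual_basis F.
apply/free_redmodP; exists n, (fun k => eps (b k)); split=> [y|a].
  have [v <-] := eps_surj y; exists (fun k => c k v).
  rewrite {1}[v]bE linear_sum [X in X - _](_ : _ = \sum_k c k v *: eps (b k)).
    by rewrite subrr; exact: (submod0 (pmul_submod X I)).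
  by apply: eq_bigr => k _; rewrite linearZ_LR.
have -> : \sum_k a k *: eps (b k) = eps (\sum_k a k *: b k).
  by rewrite linear_sum; apply: eq_bigr => k _; rewrite linearZ_LR.
move=> /kI/pmul_vect h k; have := h (c k); rewrite linear_sum (bigD1 k) //= big1.
  by rewrite addr0 linearZ_LR /= cb eqxx [_ *: _]mulr1.
by move=> l lk; rewrite linearZ_LR /= cb eq_sym (negPf lk); apply: mulr0.
Qed.

Hypothesis eps_min : forall k, eps k = 0 -> k \in pmul m (full F).

(* With A and C the matrices expressing the generators of X given by F in terms
   of a basis of X / I X and conversely, C A = 1 mod I makes A C idempotent
   mod I, and it is invertible by minimality. *)
Lemma ulrich_cover_ker : free_module (redmod I X) ->
  forall k, eps k = 0 -> k \in pmul I (full F).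
Proof.
move=> /free_redmodP[n' [b' [gen ind]]] k0 ek0.
have [n [b [c [bE cb]]]] := dual_basis F.
have /boolp.choice[a aE] (k : 'I_n) := gen (eps (b k)).
have /boolp.choice[w wE] (k : 'I_n') := eps_surj (b' k).
pose A := \matrix_(k, l) a k l : 'M_(n, n').
pose C := \matrix_(k, l) c l (w k) : 'M_(n', n).
have hX := pmul_submod X I.
have bA (v : 'rV_n) :
    \sum_k v 0 k *: eps (b k) - \sum_l (v *m A) 0 l *: b' l \in pmul I (full X).
  rewrite [X in _ - X](_ : _ = \sum_k v 0 k *: \sum_l a k l *: b' l).
    rewrite -sumrB; apply: (submod_sum hX) => k _; rewrite -scalerBr.
    exact: (submodZ hX).
  under eq_bigr do rewrite mxE scaler_suml.
  rewrite exchange_big; apply: eq_bigr => k _; rewrite scaler_sumr.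
  by apply: eq_bigr => l _; rewrite mxE scalerA.
have bC (v : 'rV_n') : \sum_l v 0 l *: b' l = \sum_k (v *m C) 0 k *: eps (b k).
  transitivity (\sum_l v 0 l *: \sum_k c k (w l) *: eps (b k)).
    apply: eq_bigr => l _; rewrite -wE {1}[w l]bE linear_sum; congr (_ *: _).
    by apply: eq_bigr => k _; rewrite linearZ_LR.
  under [RHS]eq_bigr do rewrite mxE scaler_suml.
  rewrite [RHS]exchange_big; apply: eq_bigr => l _; rewrite scaler_sumr.
  by apply: eq_bigr => k _; rewrite mxE scalerA.
have CA (v : 'rV_n') l : (v - v *m C *m A) 0 l \in I.
  apply: (ind (fun l => (v - v *m C *m A) 0 l)).
  under eq_bigr do rewrite mxE scalerDl mxE scaleNr.
  by rewrite sumrB bC; apply: bA.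
have AC (v : 'rV_n) : \sum_k (v - v *m A *m C) 0 k *: eps (b k) \in pmul I (full X).
  under eq_bigr do rewrite mxE scalerDl mxE scaleNr.
  by rewrite sumrB -bC; apply: bA.
have ACm (v : 'rV_n) k : (v - v *m A *m C) 0 k \in m.
  have /pmul_eps[u uI uE] := AC v.
  have : \sum_k (v - v *m A *m C) 0 k *: b k - u \in pmul m (full F).
    apply: eps_min; rewrite linearB uE linear_sum.
    by under eq_bigr do rewrite linearZ_LR; rewrite subrr.
  move=> /pmul_vect/(_ (c k)); rewrite linearB => h.
  rewrite -[X in X \in m](subrK (c k u)) rpredD //; last first.
    by apply: Im; move: (c k); apply/pmul_vect.
  move: h; congr (_ - _ \in m); rewrite linear_sum (bigD1 k) //= big1 ?addr0.
    by rewrite linearZ_LR /= cb eqxx [_ *: _]mulr1.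
  by move=> l lk; rewrite linearZ_LR /= cb eq_sym (negPf lk); apply: mulr0.
(* By minimality A C is 1 modulo m, hence invertible with inverse B. For the coordinates v of k0,
   independence gives v A = 0 modulo I, and v = (v A) C B. *)
have [|B BD DB] := @inv_1Bmx _ m noethR locR _ (1%:M - A *m C).
  move=> k l; have := ACm (delta_mx 0 k) l.
  by rewrite -mulmxA -[X in X - _]mulmx1 -mulmxBr -rowE mxE.
rewrite opprB addrC subrK in BD DB.
pose v := \row_k c k k0.
have vA l : (v *m A) 0 l \in I.
  apply: (ind (fun l => (v *m A) 0 l)); have := bA v.
  rewrite (_ : \sum_k v 0 k *: eps (b k) = 0).
    by rewrite sub0r => /(submodN hX); rewrite opprK.
  transitivity (eps k0); last exact: ek0.
  have -> : eps k0 = eps (\sum_k c k k0 *: b k) by rewrite -bE.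
  by rewrite linear_sum; apply: eq_bigr => k _; rewrite linearZ_LR mxE.
have mulI p q (Z : 'M_(p, q)) (z : 'rV_p) : (forall l, z 0 l \in I) ->
    forall l, (z *m Z) 0 l \in I.
  by move=> hz l; rewrite mxE; apply: rpred_sum => i _; rewrite mulrC idealMr.
rewrite [k0]bE; apply: (submod_sum (pmul_submod F I)) => k _; apply: mem_pmul.
have -> : c k k0 = (v *m A *m C *m B) 0 k.
  by rewrite -[v *m A *m C]mulmxA -mulmxA DB mulmx1 mxE.
by apply: (mulI); apply: mulI.
Qed.

Lemma ulrich_ulrich_cover : pmul I (full X) =i pmul (pideal x) (full X) ->
  free_module (redmod I X) -> ulrich_cover.
Proof.
move=> IQ /ulrich_cover_ker kI v; split=> [vI|[k /kI kI' /qmul_pmul vk]].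
  have : eps v \in pmul I (full X) by apply/pmul_eps; exists v.
  rewrite IQ => /qmulP/(qmul_lift eps_surj)[u qu uE].
  by exists (v - u); [rewrite linearB uE subrr|rewrite subKr].
by rewrite -(subrK k v); apply: (submodD (pmul_submod F I)).
Qed.

End Criterion.

(** A functional with a unit value takes the value 1 at some z, and then R z is a free direct
    summand with complement the kernel. *)
Lemma stable_dual (M : lmodType R) (phi : {linear M -> R^o}) :
  stable M -> forall y, phi y \in m.
Proof.
move=> hM y; apply: contrapT => ym.
have [a ay] := local_unit noethR locR (introN idP ym).
have [z pz] : exists z, phi z = 1 by exists (a *: y); rewrite linearZ_LR.
have [K [f [fi fE]]] := sub_exists (ker_submod phi).
have [g gE] : exists g : {linear ('rV[R]_1 * K)%type -> M},
    forall p, g p = p.1 0 0 *: z + f p.2.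
  apply: linP => b p q /=; rewrite !mxE linearP scalerDl scalerDr scalerA.
  by rewrite addrACA.
have pf k : phi (f k) = 0 by apply/fE; exists k.
suff gb : bijective g by have := hM 1%N K g gb.
have gi : injective g.
  move=> [u k] [v l]; rewrite !gE /= => e.
  have := congr1 phi e; rewrite !linearD !linearZ_LR pz !pf !addr0.
  rewrite ![_ *: 1]mulr1 => uv; congr (_, _).
    by apply/rowP => i; rewrite !ord1.
  by apply: fi; move: e; rewrite uv => /addrI.
have gs w : exists p, g p = w.
  have /fE[k kE] : phi (w - phi w *: z) = 0.
    by rewrite linearB linearZ_LR pz [_ *: 1]mulr1 subrr.
  by exists (const_mx (phi w), k); rewrite gE /= mxE kE addrC subrK.
have [h hE] := boolp.choice gs; exists h => // p.
by apply: gi; rewrite hE.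
Qed.

End FreeCovers.

(** * The module lambda M and the comparison with M *)

Section Lambda.
Variables (R : comNzRingType) (m : idealr R) (M : lmodType R).
Hypotheses (noethR : noetherian R) (locR : local_ring m).
Variables (P : min_presentation m M) (P' : min_presentation m (transpose P)).

Lemma transpose_proj : exists pi : {linear 'Hom(pres_F1 P, R^o) -> transpose P},
  (forall y, exists psi, pi psi = y) /\
  forall psi, pi psi = 0 <-> exists phi, dual (pres_d P) phi = psi.
Proof.
have pl : linear (fun psi => \pi_(transpose P) psi).
  move=> a u v; rewrite -[a *: \pi_(transpose P) u]/(quot_scale a _).
  rewrite quot_scaleE; exact: raddfD.
exists (mklin pl); split=> [y|psi]; first by exists (repr y); rewrite /= reprK.
by apply: iff_trans (pi_eq0 _ _) _; split=> [/asboolP|?]; last apply/asboolP.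
Qed.

(** Since im d lies in m F0, the projection of the dual of F1 onto Tr M is a minimal cover. It is
    thus isomorphic to the cover chosen in [P'], and lambda M becomes the image of [dual d]. *)
Lemma lambda_cover : exists eps : {linear 'Hom(pres_F0 P, R^o) -> lambda P'},
  (forall y, exists phi, eps phi = y) /\
  forall phi, eps phi = 0 <-> dual (pres_d P) phi = 0.
Proof.
have [pi [pis piE]] := transpose_proj.
have [|h [hE hi hs]] := minimal_cover_unique noethR locR pis (pres_surj P') _
    (@pres_min0 _ _ _ P').
  move=> psi /piE[phi <-]; apply/pmul_dual => v; rewrite comp_lfunE.
  have /pmul_vect : pres_d P v \in pmul m (full (pres_F0 P)).
    by apply: pres_min0; apply/pres_exact; exists v.
  exact.
have vl : linear (fun y : lambda P' => val y) by move=> a u v.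
pose f := mklin vl; have fi : injective f by exact: val_inj.
have [p pE] : exists p : {linear 'Hom(pres_F0 P, R^o) -> lambda P'},
    forall phi, f (p phi) = h (dual (pres_d P) phi).
  apply: (factor_inj (g := h \o dual (pres_d P)) fi) => phi.
  have hp : h (dual (pres_d P) phi) \in image_pred (pres_d P').
    by apply/asboolP/pres_exact; rewrite hE; apply/piE; exists phi.
  exists (Sub (h (dual (pres_d P) phi)) hp : submod_of (image_pred (pres_d P'))).
  exact: SubK.
exists p; split=> [y|phi]; last first.
  split=> [p0|d0]; first by apply: hi; rewrite -pE p0 !linear0.
  by apply: fi; rewrite pE d0 !linear0.
have [psi psiE] := hs (f y).
have /piE[phi phiE] : pi psi = 0.
  rewrite -hE psiE; apply/pres_exact; exact/asboolP/(valP y).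
by exists phi; apply: fi; rewrite pE phiE.
Qed.

End Lambda.

Lemma krull_dim_unique (R : comNzRingType) d d' :
  krull_dim R d -> krull_dim R d' -> d = d'.
Proof.
move=> [c h] [c' h']; apply/eqP; rewrite eqn_leq h //.
by rewrite h'.
Qed.

Theorem corollary4p4 (R : comNzRingType) (m : idealr R) (d : nat)
    (hR : gorenstein_local m) (hd : krull_dim R d)
    (I : idealr R) (hI : m_primary m I)
    (x : d.-tuple R) (hx : sop m x) (hred : reduction (pideal x) I)
    (hIU : ulrich_ideal (pideal x) I) (hIp : ~ parameter_ideal m I)
    (M : lmodType R) (hMst : stable M) (hM : max_CM m M)
    (P : min_presentation m M) (P' : min_presentation m (transpose P)) :
  ulrich_module m (pideal x) I M <->
  ulrich_module m (pideal x) I (lambda P').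
Proof.
have [noethR locR finR] := hR.
have [E [n0 En0]] := finite_injdim_injres finR.
have [e fin soc] := injdim_exists noethR locR En0.
have [fgM [d' hd' [[s [ss sm /regular_seqP[sreg sne]]] _]]] := hM.
have dd := krull_dim_unique hd hd'; rewrite -{d' hd'}dd in ss.
rewrite ss in sreg sne.
have {}fgM : fg M by apply/fin_gen_fg.
have smi i : (i < d)%N -> s`_i \in m by move=> lt; apply: sm; rewrite mem_nth ?ss.
(* The sequence s, regular on M, and the generators x of Q are unrelated. The length of s gives d <=
   e, which makes x short enough for [sop_regular]. *)
have [z zE] := max_depth_socle noethR locR sreg sne hd.2.
have de := injdim_ge_depth noethR locR fin soc fgM sreg smi zE.
have [_ xm xprim] := hx; have sx := size_tuple x.
have [xreg ed] : wreg R^o x (size x) /\ e = size x.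
  by apply: (sop_regular noethR locR soc xm xprim); rewrite sx.
have vM : vanish E M 1.
  by have := wreg_vanish noethR locR fin fgM sreg smi; rewrite ed sx subSnn.
subst e.
have xmi i : (i < size x)%N -> x`_i \in m by move=> lt; apply: xm; rewrite mem_nth.
have QI : {subset pideal x <= I} := hred.1.
have IQ : ~ {subset I <= pideal x}.
  by move=> h; apply: hIp; exists x => // a; apply/idP/idP; [apply: h|apply: QI].
have colon c := @colon_ulrich R m I x noethR locR hI xreg QI IQ hIU c.
have Im : {subset I <= m} by move=> a aI; apply/hI.2; exists 1%N.
have sqQ a b : a \in I -> b \in I -> qmul (M := R^o) x (size x) (a * b).
  move=> aI bI; have [t _ ->] := ideal_sq hIU aI bI.
  apply: (submod_sum (qmul_submod R^o x (size x))) => i _; rewrite mulrC.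
  exact: (mem_qmul (M := R^o)).
have colonq c : (forall u, u \in I -> qmul (M := R^o) x (size x) (u * c)) -> c \in I.
  by move=> h; apply: colon => u uI; apply/qmul_ideal; rewrite mulrC; apply: h.
have [pi [pis piE]] := transpose_proj P.
have [eps [epss epsE]] := lambda_cover noethR locR P'.
have kerP := @pres_exact _ _ _ P; have surP := pres_surj P.
set d1 := pres_d P in piE epsE kerP; set F0 := pres_F0 P in epsE.
have hQ := qmul_submod R^o x (size x).
have dlift := dual_lift noethR xreg vM surP kerP.
have ddlift := double_dual_lift noethR locR fin xmi xreg vM surP kerP pis piE.
have kerM (phi : 'Hom(F0, R^o)) v : dual d1 phi = 0 -> phi (d1 v) = 0.
  by move=> /lfunP/(_ v); rewrite comp_lfunE zero_lfunE.
(* This is where I^2 inside Q is used; the reverse inclusions in [UU] use Q : I = I instead. *)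
have evIQ (phi : 'Hom(F0, R^o)) w : (forall v, phi v \in I) ->
    w \in pmul I (full F0) -> qmul x (size x) (phi w).
  move=> phiI; apply: (pmul_sub (preim_submod phi hQ)) => a u aI.
  by rewrite linearZ_LR; exact: (sqQ a _ aI (phiI u)).
have UU : ulrich_cover I x (pres_eps P) <-> ulrich_cover I x eps.
  split=> hU.
    move=> phi; split=> [/pmul_dual phiI|[th /epsE th0 /qmul_dual q]].
      have [|th /epsE th0 q] := dlift (size x) phi (leqnn _); last by exists th.
      move=> v; apply: evIQ => //; apply/hU; exists (d1 v).
        by apply/kerP; exists v.
      rewrite subrr; exact: (submod0 (qmul_submod _ _ _)).
    (* For a in I write a v = d u modulo Q F0. Since th kills im d, a phi(v) is (phi - th)(d u)
       modulo Q, hence lies in Q. *)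
    apply/pmul_dual => v; apply: colonq => a aI.
    have /hU[k /kerP[u <-] qk] : a *: v \in pmul I (full F0) by apply: mem_pmul.
    have -> : a * phi v = phi (a *: v - d1 u) + (phi - th) (d1 u).
      rewrite add_lfunE opp_lfunE (kerM th) // subr0 linearB subrK.
      by rewrite linearZ_LR.
    by apply: (submodD hQ); [apply: qmul_lin|apply: q].
  move=> v; split=> [vI|[k /kerP[u <-] qk]].
    have [|u qu] := ddlift (size x) v (leqnn _); last first.
      by exists (d1 u) => //; apply/kerP; exists u.
    move=> th th0; apply: evIQ => //; apply/pmul_dual/hU; exists th; first exact/epsE.
    rewrite subrr; exact: (submod0 (qmul_submod _ _ _)).
  apply/pmul_vect => phi; apply: colonq => a aI.
  have /hU[th /epsE th0 /qmul_dual q] : a *: phi \in pmul I (full 'Hom(F0, R^o)).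
    exact: mem_pmul.
  have -> : a * phi v = (a *: phi - th) v + th (v - d1 u).
    rewrite [th (_ - _)]linearB /= (kerM th) // subr0.
    by rewrite add_lfunE opp_lfunE subrK scale_lfunE.
  by apply: (submodD hQ); [apply: q|apply: qmul_lin].
have epsm phi : eps phi = 0 -> phi \in pmul m (full 'Hom(F0, R^o)).
  move=> /epsE phi0; apply/pmul_dual => v.
  have [|th thE] := factor_surj (f := phi) surP.
    by move=> u /kerP[w <-]; apply: kerM.
  by rewrite -thE; apply: (stable_dual noethR locR).
(* For the converse M is maximal Cohen-Macaulay by hypothesis, so only the conditions modulo I
   remain. *)
split=> -[mcm IQM frM]; last first.
  have [h1 h2] := ulrich_cover_ulrich QI surP
    (UU.2 (ulrich_ulrich_cover noethR locR Im QI epss epsm IQM frM)).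
  by split.
have U' := UU.1 (ulrich_ulrich_cover noethR locR Im QI surP (@pres_min0 _ _ _ P) IQM frM).
have [h1 h2] := ulrich_cover_ulrich QI epss U'; split=> //.
(* If x_i phi lies in M^* modulo the earlier elements, then phi maps im d into their ideal, as x_i
   is regular on R; [dual_lift] moves phi into M^* modulo that ideal. *)
have lreg : wreg (lambda P') x (size x).
  move=> i lt y; have [phi <-] := epss y; rewrite -linearZ_LR.
  move=> /(qmul_lift epss)[phi' /qmul_dual q' /eqP]; rewrite eq_sym -subr_eq0 -linearB.
  move=> /eqP/epsE e0; have [|th /epsE th0 q] := dlift i phi (ltnW lt).
    move=> v; apply: xreg => //; have := q' (d1 v).
    have := kerM _ v e0; rewrite add_lfunE opp_lfunE scale_lfunE => /eqP.
    by rewrite subr_eq0 => /eqP->.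
  by rewrite -[phi](subrK th) linearD th0 addr0; apply: qmul_lin.
(* If Q lambda M were all of lambda M, every functional on F0 would have values in I. A dual basis
   functional takes the value 1, so F0 = 0 and M = 0, against the choice of s. *)
have lne : exists y : lambda P', ~ qmul x (size x) y.
  apply: contrapT => none.
  have all phi : qmul x (size x) (eps phi).
    by apply: contrapT => h; apply: none; exists (eps phi).
  have {}all (phi : 'Hom(F0, R^o)) : forall v, phi v \in I.
    apply/pmul_dual/U'; have [phi' q' e] := qmul_lift epss (all phi).
    by exists (phi - phi'); [rewrite linearB e subrr|rewrite subKr].
  have [n [b [c [bE cb]]]] := dual_basis F0; case: n => [|n] in b c bE cb *.
    case: sne => y; apply; have [u <-] := surP y.
    by rewrite [u]bE big_ord0 linear0; exact: (submod0 (qmul_submod _ _ _)).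
  by have := all (c ord0) (b ord0); rewrite cb eqxx idealr1.
split; first exact/fin_gen_fg/(fg_surj epss (fg_vect _)).
exists d => //; split; first by exists x; split=> //; apply/regular_seqP.
move=> t tm /regular_seqP[treg tne]; apply: hd.2.
exact: (depth_le_dim noethR locR treg tne).
Qed.
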